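(* Let $R$ be a local ring of positive depth. Then the following are equivalent. (1) $R$ satisfies (SAC). (2) $\mathrm{rfed}(R)<\infty$. (3) There is an integer $n\ge 0$ such that $\mathrm{rfed}_n(R)<\infty$.
   Context: All rings are commutative Noetherian with identity. A ring $R$ satisfies (SAC) if for each finitely generated $R$-module $M$: whenever $\mathrm{Ext}_R^i(M,R)=0$ for all $i>0$ and $\mathrm{Ext}_R^i(M,M)=0$ for all sufficiently large $i$, one has $\mathrm{Ext}_R^i(M,M)=0$ for all $i>0$. For a finitely generated $R$-module $M$, the self-extension degree is $\mathrm{ext.deg}(M):=\sup\{i\mid \mathrm{Ext}_R^i(M,M)\ne0\}$. The restricted finitistic extension degree of $R$ is $\mathrm{rfed}(R):=\sup\{\mathrm{ext.deg}(M\oplus R)\mid \mathrm{ext.deg}(M\oplus R)<\infty\}$, with $M$ ranging over finitely generated $R$-modules. For an integer $n\ge0$, $\mathrm{rfed}_n(R):=\sup\{\mathrm{ext.deg}(M\oplus R)\mid M \text{ has constant rank } n \text{ and } \mathrm{ext.deg}(M\oplus R)<\infty\}$, with $M$ ranging over finitely generated $R$-modules. A finitely generated $R$-module $M$ has constant rank $r$ if $M\otimes_R Q$ is a free $Q$-module of rank $r$, where $Q$ is the total ring of fractions of $R$. *)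

(* Defs.v *)
From HB Require Import structures.
From mathcomp Require Import all_boot all_order all_algebra.
From mathcomp Require Import generic_quotient ring_quotient ring.
From mathcomp Require Import boolp classical_sets functions cardinality fsbigop.
From mathcomp Require Import reals constructive_ereal ereal Rstruct.

Set Implicit Arguments.
Unset Strict Implicit.
Unset Printing Implicit Defensive.

Import Order.TTheory GRing.Theory Num.Theory.
Local Open Scope classical_set_scope.
Local Open Scope ring_scope.

Section Span.
Variables (R : pzRingType) (V : lmodType R).
Implicit Types (A : set V) (W : {pred V}).

Definition lspan A : {pred V} :=
  fun v => `[< forall W, submod_closed W -> (forall a, A a -> a \in W) ->
               v \in W >].

Lemma lspan_submod A : submod_closed (lspan A).
Proof.
split=> [|a u v /asboolP hu /asboolP hv]; apply/asboolP => W Wsub AW.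
  by case: Wsub.
by case: (Wsub) => _; apply; [exact: hu | exact: hv].
Qed.

HB.instance Definition _ A :=
  GRing.isSubmodClosed.Build R V (lspan A) (lspan_submod A).

End Span.

Section QuotientModule.
Variables (R : pzRingType) (V : lmodType R) (W : submodClosed V).

Definition submod_pred : {pred V} := W.
HB.instance Definition _ := GRing.isZmodClosed.Build V submod_pred
  (submodClosedP W : zmod_closed _).

Definition quomod := Quotient.quot submod_pred.
HB.instance Definition _ := GRing.Zmodule.on quomod.
HB.instance Definition _ := @ZmodQuotient.on quomod.

Definition quoscale (a : R) (x : quomod) : quomod :=
  \pi_quomod%qT (a *: repr x).

Lemma pi_scale a (v : V) :
  quoscale a (\pi_quomod%qT v) = \pi_quomod%qT (a *: v).
Proof.
apply/eqP; rewrite -Quotient.idealrBE -scalerBr.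
apply: (rpredZ (s := W)); change (repr (\pi_quomod%qT v) - v \in submod_pred).
by rewrite Quotient.idealrBE reprK.
Qed.

Fact quoscaleA a b x : quoscale a (quoscale b x) = quoscale (a * b) x.
Proof. by elim/quotW: x => v; rewrite !(pi_scale _ v) pi_scale scalerA. Qed.
Fact quoscale1 : left_id 1 quoscale.
Proof. by elim/quotW => v; rewrite pi_scale scale1r. Qed.
Fact quoscaleDr : right_distributive quoscale +%R.
Proof.
move=> a; elim/quotW => u; elim/quotW => v.
by rewrite -raddfD !pi_scale scalerDr raddfD.
Qed.
Fact quoscaleDl x : {morph quoscale^~ x : a b / a + b}.
Proof.
by elim/quotW: x => v a b; rewrite !pi_scale scalerDl raddfD.
Qed.
HB.instance Definition _ := GRing.Zmodule_isLmodule.Build R quomod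
  quoscaleA quoscale1 quoscaleDr quoscaleDl.

End QuotientModule.

Section FreeModule.
Variables (R : pzRingType) (X : choiceType).

Definition finsupport : {pred X -> R^o} :=
  fun f => `[< finite_set [set x | f x != 0] >].

Lemma finsupport_submod : submod_closed finsupport.
Proof.
split=> [|a f g /asboolP hf /asboolP hg]; apply/asboolP.
  by apply: (sub_finite_set _ (finite_set0 X)) => x /=; rewrite eqxx.
apply: (sub_finite_set _ (_ : finite_set ([set x | f x != 0] `|`
                                          [set x | g x != 0]))).
  move=> x /=; case: (eqVneq (f x) 0) => [fx0|]; last by left.
  case: (eqVneq (g x) 0) => [gx0|]; last by right.
  by rewrite [X in X != _](_ : _ = a *: f x + g x) // fx0 gx0 scaler0 addr0 eqxx.
by rewrite finite_setU.
Qed.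

HB.instance Definition _ :=
  GRing.isSubmodClosed.Build R (X -> R^o) finsupport finsupport_submod.

Definition freemod := {f : X -> R^o | f \in finsupport}.
HB.instance Definition _ := SubChoice.on freemod.
HB.instance Definition _ := [SubChoice_isSubLmodule of freemod by <:].

Fact freebasis_subproof (x : X) :
  (fun y => (y == x)%:R : R^o) \in finsupport.
Proof.
apply/asboolP; apply: (sub_finite_set _ (finite_set1 x)) => y /=.
by case: (y =P x) => // _; rewrite eqxx.
Qed.
Definition freebasis (x : X) : freemod :=
  exist _ (fun y => (y == x)%:R : R^o) (freebasis_subproof x).

Variables (M : lmodType R) (g : X -> M).

(* [val c] has finite support, so this is a finite sum *)
Definition freelift (c : freemod) : M := \sum_(x \in setT) (val c x : R) *: g x.

Lemma freelift_linear : linear freelift.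
Proof.
move=> a c d.
pose S := [set x | val c x != 0] `|` [set x | val d x != 0].
have finS : finite_set S.
  by rewrite finite_setU; split; apply/asboolP; [exact: (valP c) | exact: (valP d)].
have liftE (e : freemod) : (forall x, ~ S x -> val e x = 0) ->
    freelift e = \sum_(x \in S) (val e x : R) *: g x.
  move=> eS; symmetry; apply: fsbig_widen => // x [_ /= /eS ->].
  by rewrite scale0r.
have c0 x : ~ S x -> val c x = 0.
  by move=> nSx; apply/eqP; apply: contra_notT nSx; left.
have d0 x : ~ S x -> val d x = 0.
  by move=> nSx; apply/eqP; apply: contra_notT nSx; right.
rewrite !liftE //; last first.
  move=> x nSx; rewrite [LHS](_ : _ = a *: val c x + val d x) //.
  by rewrite c0 ?d0 // scaler0 addr0.
rewrite !fsbig_finite //= scaler_sumr -big_split /=; apply: eq_bigr => x _.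
by rewrite scalerA -scalerDl.
Qed.

HB.instance Definition _ :=
  GRing.isLinear.Build R freemod M _ freelift freelift_linear.

Lemma freelift_basis x : freelift (freebasis x) = g x.
Proof.
rewrite /freelift -(@fsbig_widen X _ _ _ [set x]) //=; last first.
  by move=> y [_ /= /eqP/negPf yx]; rewrite /freebasis /= yx scale0r.
by rewrite fsbig_set1 /= eqxx scale1r.
Qed.

End FreeModule.
Arguments freemod R X : clear implicits.
Arguments freebasis {R X}.

(** [Ext] is computed from the canonical free resolution
    [... -> F_1 -> F_0 -> M -> 0] with [F_i := R^(Omega^i M)], where
    [Omega M] is the kernel of [R^(M) -> M]. *)

Section Resolution.
Variables (R : comNzRingType) (M : lmodType R).

Definition freecover : freemod R M -> M := freelift id.
HB.instance Definition _ := GRing.Linear.on freecover.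

Definition syzygy_pred : {pred freemod R M} := fun c => freecover c == 0.
Lemma syzygy_submod : submod_closed syzygy_pred.
Proof.
split=> [|a c d /eqP hc /eqP hd]; rewrite unfold_in /syzygy_pred ?linear0 //.
by rewrite linearP /= hc hd scaler0 addr0.
Qed.
HB.instance Definition _ :=
  GRing.isSubmodClosed.Build R (freemod R M) syzygy_pred syzygy_submod.

Definition syzygy := {c : freemod R M | c \in syzygy_pred}.
HB.instance Definition _ := SubChoice.on syzygy.
HB.instance Definition _ := [SubChoice_isSubLmodule of syzygy by <:].

End Resolution.

Section Ext.
Variable R : comNzRingType.
Implicit Types M N : lmodType R.

Definition itersyzygy i M : lmodType R :=
  iter i (@syzygy R : lmodType R -> lmodType R) M.

Definition resol i M : lmodType R := freemod R (itersyzygy i M).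

Definition resol_diff i M : resol i.+1 M -> resol i M :=
  fun c => val (freecover c : syzygy (itersyzygy i M)).

Variables (i : nat) (M N : lmodType R).

Definition ext_cocycle : {pred resol i M -> N} :=
  fun f => `[< linear f /\ f \o @resol_diff i M = \0 >].

Lemma ext_cocycle_submod : submod_closed ext_cocycle.
Proof.
split=> [|a f g /asboolP[flin f0] /asboolP[glin g0]]; apply/asboolP.
  by split=> // b x y; rewrite [RHS]addr0 scaler0.
split=> [b x y|].
  rewrite -[LHS]/(a *: f (b *: x + y) + g (b *: x + y)) flin glin.
  by rewrite !scalerDr !scalerA mulrC addrACA -!scalerA -scalerDr.
apply/funext => x; rewrite -[LHS]/(a *: (f \o _) x + (g \o _) x) f0 g0 /=.
by rewrite scaler0 addr0.
Qed.
HB.instance Definition _ := GRing.isSubmodClosed.Build R (resol i M -> N)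
  ext_cocycle ext_cocycle_submod.

Definition cocycle := {f : resol i M -> N | f \in ext_cocycle}.
HB.instance Definition _ := SubChoice.on cocycle.
HB.instance Definition _ := [SubChoice_isSubLmodule of cocycle by <:].

End Ext.

Section ExtModule.
Variables (R : comNzRingType) (i : nat) (M N : lmodType R).

Definition ext_coboundary : {pred cocycle i M N} :=
  match i with
  | 0 => fun f => `[< val f = \0 >]
  | j.+1 => fun f =>
      `[< exists2 g : resol j M -> N,
            linear g & val f = g \o @resol_diff R j M >]
  end.

Lemma ext_coboundary_submod : submod_closed ext_coboundary.
Proof.
rewrite /ext_coboundary; case: i => [|j].
  split=> [|a f g /asboolP f0 /asboolP g0]; apply/asboolP => //.
  by rewrite linearP /= f0 g0; apply/funext => x; rewrite [LHS]addr0 scaler0.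
split=> [|a f g /asboolP[f' flin fE] /asboolP[g' glin gE]]; apply/asboolP.
  by exists \0 => // b x y; rewrite /= scaler0 addr0.
exists (a *: f' + g'); last by rewrite linearP /= fE gE.
move=> b x y.
rewrite -[LHS]/(a *: f' (b *: x + y) + g' (b *: x + y)) flin glin.
by rewrite !scalerDr !scalerA mulrC addrACA -!scalerA -scalerDr.
Qed.
HB.instance Definition _ := GRing.isSubmodClosed.Build R (cocycle i M N)
  ext_coboundary ext_coboundary_submod.

Definition Ext : lmodType R := quomod ext_coboundary.

End ExtModule.

Section TotalFractions.
Variable R : comNzRingType.

Definition nonzerodivisor : {pred R} := fun s => `[< GRing.lreg s >].

Definition prefrac := {x : R * R | x.2 \in nonzerodivisor}.
HB.instance Definition _ := Choice.on prefrac.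

Implicit Types x y z : prefrac.
Local Notation num x := (val x).1.
Local Notation den x := (val x).2.

Lemma den_lreg x : GRing.lreg (den x). Proof. exact/asboolP/(valP x). Qed.
Arguments den_lreg : clear implicits.

Fact mkfrac_subproof (a s : R) : GRing.lreg s -> (a, s).2 \in nonzerodivisor.
Proof. by move=> ?; apply/asboolP. Qed.
Definition mkfrac (a s : R) (sreg : GRing.lreg s) : prefrac :=
  exist _ (a, s) (mkfrac_subproof a sreg).

(* cross-multiplying suffices, as the denominators are regular *)
Definition fraceq x y := num x * den y == num y * den x.

Lemma fraceq_refl : reflexive fraceq. Proof. by move=> x; apply/eqP. Qed.
Lemma fraceq_sym : symmetric fraceq.
Proof. by move=> x y; rewrite /fraceq eq_sym. Qed.
Lemma fraceq_trans : transitive fraceq.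
Proof.
move=> y x z /eqP xy /eqP yz; apply/eqP; apply: (den_lreg y).
transitivity (num x * den y * den z); first by ring.
rewrite xy; transitivity (num y * den z * den x); first by ring.
by rewrite yz; ring.
Qed.
Canonical fraceq_equiv := EquivRel fraceq fraceq_refl fraceq_sym fraceq_trans.

Definition totfrac := {eq_quot fraceq}%qT.
HB.instance Definition _ : EqQuotient _ fraceq totfrac := EqQuotient.on totfrac.
HB.instance Definition _ := Choice.on totfrac.

Lemma fraceq_repr x :
  num (repr (\pi_totfrac%qT x)) * den x = num x * den (repr (\pi_totfrac%qT x)).
Proof. by apply/eqP; rewrite -[_ == _]/(fraceq _ _) -eqmodE reprK. Qed.

Lemma lregM_den x y : GRing.lreg (den x * den y).
Proof. by apply: lregM; exact: den_lreg. Qed.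
Arguments lregM_den : clear implicits.

Definition pre0 := mkfrac 0 (@GRing.lreg1 R).
Definition pre1 := mkfrac 1 (@GRing.lreg1 R).
Definition preopp x := mkfrac (- num x) (den_lreg x).
Definition preadd x y :=
  mkfrac (num x * den y + num y * den x) (lregM_den x y).
Definition premul x y := mkfrac (num x * num y) (lregM_den x y).

Definition totfrac0 : totfrac := \pi%qT pre0.
Definition totfrac1 : totfrac := \pi%qT pre1.
Definition totfrac_opp := lift_op1 totfrac preopp.
Definition totfrac_add := lift_op2 totfrac preadd.
Definition totfrac_mul := lift_op2 totfrac premul.

Lemma pi_opp x : totfrac_opp (\pi%qT x) = \pi%qT (preopp x).
Proof.
unlock totfrac_opp; apply/eqmodP/eqP => /=.
by rewrite mulNr fraceq_repr mulNr.
Qed.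

Lemma pi_add x y : totfrac_add (\pi%qT x) (\pi%qT y) = \pi%qT (preadd x y).
Proof.
unlock totfrac_add; apply/eqmodP/eqP => /=.
have := fraceq_repr x; move: (repr (\pi_totfrac%qT x)) => x' ex.
have := fraceq_repr y; move: (repr (\pi_totfrac%qT y)) => y' ey.
transitivity (num x' * den x * (den y' * den y) + num y' * den y * (den x' * den x)).
  by ring.
by rewrite ex ey; ring.
Qed.

Lemma pi_mul x y : totfrac_mul (\pi%qT x) (\pi%qT y) = \pi%qT (premul x y).
Proof.
unlock totfrac_mul; apply/eqmodP/eqP => /=.
have := fraceq_repr x; move: (repr (\pi_totfrac%qT x)) => x' ex.
have := fraceq_repr y; move: (repr (\pi_totfrac%qT y)) => y' ey.
transitivity (num x' * den x * (num y' * den y)); first by ring.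
by rewrite ex ey; ring.
Qed.

Lemma totfrac_eq x y :
  num x * den y = num y * den x -> \pi_totfrac%qT x = \pi_totfrac%qT y.
Proof. by move=> e; apply/eqmodP/eqP. Qed.

Fact totfrac_addA : associative totfrac_add.
Proof.
elim/quotW => x; elim/quotW => y; elim/quotW => z.
by rewrite !pi_add; apply: totfrac_eq => /=; ring.
Qed.
Fact totfrac_addC : commutative totfrac_add.
Proof.
elim/quotW => x; elim/quotW => y.
by rewrite !pi_add; apply: totfrac_eq => /=; ring.
Qed.
Fact totfrac_add0 : left_id totfrac0 totfrac_add.
Proof.
by elim/quotW => x; rewrite pi_add; apply: totfrac_eq => /=; ring.
Qed.
Fact totfrac_addN : left_inverse totfrac0 totfrac_opp totfrac_add.
Proof.
by elim/quotW => x; rewrite pi_opp pi_add; apply: totfrac_eq => /=; ring.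
Qed.
HB.instance Definition _ := GRing.isZmodule.Build totfrac
  totfrac_addA totfrac_addC totfrac_add0 totfrac_addN.

Fact totfrac_mulA : associative totfrac_mul.
Proof.
elim/quotW => x; elim/quotW => y; elim/quotW => z.
by rewrite !pi_mul; apply: totfrac_eq => /=; ring.
Qed.
Fact totfrac_mulC : commutative totfrac_mul.
Proof.
elim/quotW => x; elim/quotW => y.
by rewrite !pi_mul; apply: totfrac_eq => /=; ring.
Qed.
Fact totfrac_mul1 : left_id totfrac1 totfrac_mul.
Proof.
by elim/quotW => x; rewrite pi_mul; apply: totfrac_eq => /=; ring.
Qed.
Fact totfrac_mulDl : left_distributive totfrac_mul totfrac_add.
Proof.
elim/quotW => x; elim/quotW => y; elim/quotW => z.
by rewrite !(pi_mul, pi_add); apply: totfrac_eq => /=; ring.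
Qed.
Fact totfrac1_neq0 : totfrac1 != totfrac0.
Proof.
apply/eqP => /eqmodP/eqP /=; rewrite mul1r mul0r.
by apply/eqP; exact: oner_neq0.
Qed.
HB.instance Definition _ := GRing.Zmodule_isComNzRing.Build totfrac
  totfrac_mulA totfrac_mulC totfrac_mul1 totfrac_mulDl totfrac1_neq0.

Definition tototfrac (a : R) : totfrac := \pi%qT (mkfrac a (@GRing.lreg1 R)).

Fact tototfrac_zmod_morphism : zmod_morphism tototfrac.
Proof.
move=> a b; rewrite -[RHS]/(totfrac_add _ (totfrac_opp _)) /tototfrac pi_opp pi_add.
by apply: totfrac_eq => /=; ring.
Qed.
Fact tototfrac_monoid_morphism : monoid_morphism tototfrac.
Proof.
split=> // a b; rewrite -[RHS]/(totfrac_mul _ _) /tototfrac pi_mul.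
by apply: totfrac_eq => /=; ring.
Qed.
HB.instance Definition _ :=
  GRing.isZmodMorphism.Build R totfrac tototfrac tototfrac_zmod_morphism.
HB.instance Definition _ :=
  GRing.isMonoidMorphism.Build R totfrac tototfrac tototfrac_monoid_morphism.

End TotalFractions.

(** Extension of scalars [M (x)_R S] along [phi : R -> S], as the [S]-module
    with generators [m (x) 1] subject to [R]-linearity in [m]. *)

Section BaseChange.
Variables (R S : comNzRingType) (phi : {rmorphism R -> S}) (M : lmodType R).

Definition basechange_rel : set (freemod S M) :=
  [set v | (exists m n, v = freebasis (m + n) - freebasis m - freebasis n)
        \/ (exists a m, v = freebasis (a *: m) - phi a *: freebasis m)].

Definition basechange : lmodType S := quomod (lspan basechange_rel).

End BaseChange.

Section CommutativeAlgebra.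
Variable R : comNzRingType.
Implicit Types (M N : lmodType R) (I m : {pred R}).

Definition fingen M : Prop :=
  exists s : seq M, forall x, x \in lspan [set` s].

(* an ideal is a submodule of R^o *)
Definition noetherian : Prop :=
  forall I : {pred R^o}, submod_closed I ->
    exists s : seq R^o, I =i lspan [set` s].

(* [idealr_closed] is the library's predicate for proper ideals *)
Definition maximal_ideal m : Prop :=
  idealr_closed m /\
  forall I, idealr_closed I -> {subset m <= I} -> {subset I <= m}.

(* (R, m) is a local ring *)
Definition local_ring m : Prop :=
  maximal_ideal m /\ forall m', maximal_ideal m' -> m' =i m.

(* s_0, ..., s_(k-1) is an R-regular sequence: each s_i is a nonzerodivisor on
   R / (s_0, ..., s_(i-1)), and R / (s_0, ..., s_(k-1)) is nonzero *)
Definition regular_seq (s : seq R^o) : Prop :=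
  (forall i, (i < size s)%N -> forall x : R^o,
     s`_i * x \in lspan [set` take i s] -> x \in lspan [set` take i s]) /\
  exists x, x \notin lspan [set` s].

(* Degrees are extended reals so that suprema are the library's [ereal_sup];
   in particular the supremum of the empty set is -oo. *)
Local Notation ext_nat n := ((n%:R : Rdefinitions.R)%:E).

Definition depth m : \bar Rdefinitions.R :=
  ereal_sup [set ext_nat (size s) |
              s in [set s : seq R^o | regular_seq s /\ {subset s <= m}]].

Definition Ext_eq0 i M N : Prop := forall e : Ext i M N, e = 0.

Definition SAC : Prop :=
  forall M, fingen M ->
    (forall i, (0 < i)%N -> Ext_eq0 i M R^o) ->
    (exists k, forall i, (k <= i)%N -> Ext_eq0 i M M) ->
    forall i, (0 < i)%N -> Ext_eq0 i M M.

Definition ext_deg M : \bar Rdefinitions.R :=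
  ereal_sup [set ext_nat i | i in [set i | ~ Ext_eq0 i M M]].

Definition rfed : \bar Rdefinitions.R :=
  ereal_sup [set d | exists M, [/\ fingen M, d = ext_deg (M * R^o)%type
                                 & (d < +oo)%E]].

Definition constant_rank M (r : nat) : Prop :=
  exists f : {linear basechange (@tototfrac R) M -> 'rV[totfrac R]_r},
    bijective f.

Definition rfed_rank (n : nat) : \bar Rdefinitions.R :=
  ereal_sup [set d | exists M, [/\ fingen M, constant_rank M n,
                                 d = ext_deg (M * R^o)%type & (d < +oo)%E]].

End CommutativeAlgebra.

Arguments rfed R : clear implicits.
Arguments rfed_rank R n : clear implicits.
Arguments SAC R : clear implicits.
Arguments noetherian R : clear implicits.

(* Main.v *)
(** By the long exact sequences, a module [M] whose [Ext]-degree against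
    [M + R] is finite has a syzygy [N] such that [N + Omega N] satisfies the
    hypotheses of (SAC). Then [Ext^1(N, Omega N) = 0], so [N] is projective and
    [M] has finite projective dimension, which is at most the length of any
    maximal regular sequence (Auslander-Buchsbaum). This gives (1) => (2).

    For (3) => (1), let [M] satisfy the hypotheses of (SAC) and let [x] in the
    maximal ideal be regular. With [A = Omega M] and [A' = Omega^(D+1) M], the
    module [A / x A + A' / x A' + R^n] has constant rank [n] and finite
    [Ext]-degree, hence [Ext]-degree at most a bound [D] independent of [M]. By
    Nakayama's lemma, [Ext^i(A, A') = 0] for all [i > D], and these groups are
    the [Ext^(i-D)(M, M)].

    Only the vanishing of [Ext] is ever used, so the long exact sequences are
    replaced by statements about extending and lifting linear maps. *)
Require Import Defs.
From HB Require Import structures.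
From mathcomp Require Import all_boot all_order all_algebra.
From mathcomp Require Import generic_quotient ring_quotient.
From mathcomp Require Import boolp classical_sets functions cardinality fsbigop.
From mathcomp Require Import reals constructive_ereal ereal Rstruct.

Set Implicit Arguments.
Unset Strict Implicit.
Unset Printing Implicit Defensive.

Import Order.TTheory GRing.Theory Num.Theory.
Local Open Scope classical_set_scope.
Local Open Scope ring_scope.

(** * Linear maps and short exact sequences *)

Section LinearMaps.
Variable R : comNzRingType.
Implicit Types A B C D U V W : lmodType R.

(** Both (SAC) and the invariants see self-extensions only, so vanishing between two different
    modules has to be encoded in a direct sum and read off as a summand. In (3) => (1) the bound [D]
    concerns high degrees, whereas (SAC) asks about all positive ones. When [Ext^i(M, R) = 0] for
    all [i > 0], each syzygy taken in the second argument raises the degree by one, so [D + 1]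
    syzygies push all positive degrees of [Ext(M, M)] beyond [D]. Dividing by [x] controls the rank:
    a module killed by a regular element vanishes over the total ring of fractions, and [R^n] then
    sets the rank. Positive syzygies sit in free modules, so [x] is regular on them, which it need
    not be on [M]. The division can be undone: [x] is zero on [W = A' / x A'], so [Ext^i(A, W)]
    embeds in [Ext^(i+1)(A / x A, W)], and Nakayama's lemma passes from [W] to [A']. *)

Definition dsum U V : lmodType R := (U * V)%type.

Lemma linear_exists U V (f : U -> V) : linear f ->
  exists g : {linear U -> V}, g =1 f.
Proof.
move=> flin; pose h := GRing.isLinear.Build R U V _ f flin.
by exists (HB.pack_for {linear U -> V} f h).
Qed.

Lemma linear_exists_rel U V (r : U -> V -> Prop) :
    (forall u, exists v, r u v) ->
    (forall a u v u' v' w, r u v -> r u' v' -> r (a *: u + u') w ->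
       w = a *: v + v') ->
  exists g : {linear U -> V}, forall u, r u (g u).
Proof.
move=> rex rlin; pose f u := sval (cid (rex u)).
have fP u : r u (f u) by exact: svalP (cid (rex u)).
have flin : linear f by move=> a u v; apply: (rlin a u _ v).
by have [g gE] := linear_exists flin; exists g => u; rewrite gE.
Qed.

Lemma linear_factor_surj B C D (p : {linear B -> C}) (f : {linear B -> D}) :
    (forall c, exists b, p b = c) -> (forall b, p b = 0 -> f b = 0) ->
  exists g : {linear C -> D}, forall b, g (p b) = f b.
Proof.
move=> psurj pf.
have ffib b b' : p b = p b' -> f b = f b'.
  by move=> e; apply/eqP; rewrite -subr_eq0 -linearB pf // linearB e subrr.
have [|a c d c' d' w [b <- <-] [b' <- <-] [b'' e <-]|g gP] :=
    linear_exists_rel (r := fun c d => exists2 b, p b = c & f b = d).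
- by move=> c; have [b <-] := psurj c; exists (f b), b.
- by rewrite -linearP; apply: ffib; rewrite linearP.
- by exists g => b; have [b' /ffib <-] := gP (p b).
Qed.

Lemma linear_factor_inj A B D (i : {linear A -> B}) (f : {linear D -> B}) :
    injective i -> (forall d, exists a, i a = f d) ->
  exists g : {linear D -> A}, forall d, i (g d) = f d.
Proof.
move=> iinj fi; apply: (linear_exists_rel (r := fun d a => i a = f d)) => //.
by move=> a u v u' v' w e e' e''; apply: iinj; rewrite linearP e e' e'' linearP.
Qed.

Lemma linear_pair U V W (f : {linear U -> V}) (g : {linear U -> W}) :
  exists h : {linear U -> dsum V W}, forall u, h u = (f u, g u).
Proof.
by apply: linear_exists => a u v; rewrite !linearP.
Qed.

Lemma linear_copair U V W (f : {linear U -> W}) (g : {linear V -> W}) :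
  exists h : {linear dsum U V -> W}, forall u, h u = f u.1 + g u.2.
Proof.
by apply: linear_exists => a u v; rewrite !linearP scalerDr addrACA.
Qed.

Definition short_exact A B C (i : {linear A -> B}) (p : {linear B -> C}) :=
  [/\ injective i, forall c, exists b, p b = c
    & forall b, p b = 0 <-> exists a, i a = b].

Lemma short_exact0 A B C (i : {linear A -> B}) (p : {linear B -> C}) :
  short_exact i p -> forall a, p (i a) = 0.
Proof. by case=> _ _ h a; apply/h; exists a. Qed.

Lemma short_exact_pair A B C A' B' C'
    (i : {linear A -> B}) (p : {linear B -> C})
    (i' : {linear A' -> B'}) (p' : {linear B' -> C'}) :
    short_exact i p -> short_exact i' p' ->
  exists (j : {linear dsum A A' -> dsum B B'})
         (q : {linear dsum B B' -> dsum C C'}), short_exact j q.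
Proof.
move=> [iinj psurj ip] [iinj' psurj' ip'].
have [|j jE] := linear_exists (f := fun u : dsum A A' => (i u.1, i' u.2)).
  by move=> a u v; rewrite !linearP.
have [|q qE] := linear_exists (f := fun u : dsum B B' => (p u.1, p' u.2)).
  by move=> a u v; rewrite !linearP.
exists j, q; split.
- by move=> [a a'] [b b']; rewrite !jE => -[/iinj-> /iinj'->].
- move=> [c c']; have [b <-] := psurj c; have [b' <-] := psurj' c'.
  by exists (b, b'); rewrite qE.
move=> [b b']; rewrite qE /=; split.
  move=> [/ip[a <-] /ip'[a' <-]]; exists (a, a'); by rewrite jE.
move=> [[a a']]; rewrite jE /= => -[<- <-].
by congr pair; [apply/ip; exists a | apply/ip'; exists a'].
Qed.

End LinearMaps.

Section Kernel.
Variables (R : comNzRingType) (U V : lmodType R) (f : {linear U -> V}).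

Definition ker_pred : {pred U} := fun u => f u == 0.

Lemma ker_submod : submod_closed ker_pred.
Proof.
split=> [|a u v /eqP hu /eqP hv]; rewrite unfold_in /ker_pred ?linear0 //.
by rewrite linearP hu hv scaler0 addr0.
Qed.
HB.instance Definition _ := GRing.isSubmodClosed.Build R U ker_pred ker_submod.

Definition ker_type := {u : U | u \in ker_pred}.
HB.instance Definition _ := SubChoice.on ker_type.
HB.instance Definition _ := [SubChoice_isSubLmodule of ker_type by <:].
Definition kermod : lmodType R := ker_type.


Fact kerval_subproof : exists v : {linear kermod -> U}, v =1 (val : ker_type -> U).
Proof. by apply: linear_exists => a u v; rewrite linearP. Qed.

(* sealed, so that simplification does not turn it into the projection [val] *)
Definition kerval : {linear kermod -> U} := sval (cid kerval_subproof).

Let kervalE : kerval =1 (val : ker_type -> U).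
Proof. exact: svalP (cid kerval_subproof). Qed.

Lemma kerval_inj : injective kerval.
Proof. by move=> u v; rewrite !kervalE => /val_inj. Qed.

Lemma kervalP (k : kermod) : f (kerval k) = 0.
Proof. by rewrite kervalE; exact/eqP/(valP (k : ker_type)). Qed.

Lemma kerval_ex u : f u = 0 -> exists k : kermod, kerval k = u.
Proof. by move=> /eqP fu; exists (exist _ u fu : ker_type); rewrite kervalE. Qed.

Lemma ker_short_exact : (forall v, exists u, f u = v) -> short_exact kerval f.
Proof.
move=> fsurj; split; [exact: kerval_inj | exact: fsurj | move=> u].
by split=> [/kerval_ex//|[k <-]]; exact: kervalP.
Qed.

End Kernel.

(** * Vanishing of Ext *)

Section ExtVanishing.
Variable R : comNzRingType.
Implicit Types A B C K L P Q U W Y Z : lmodType R.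

Definition projective P : Prop :=
  forall B C (p : {linear B -> C}) (f : {linear P -> C}),
    (forall c, exists b, p b = c) ->
  exists g : {linear P -> B}, forall x, p (g x) = f x.

Lemma projective_retract P Q (s : {linear P -> Q}) (r : {linear Q -> P}) :
  (forall x, r (s x) = x) -> projective Q -> projective P.
Proof.
move=> rs Qproj B C p f psurj.
have [g gP] := Qproj B C p (f \o r : {linear Q -> C}) psurj.
by exists (g \o s : {linear P -> B}) => x /=; rewrite gP /= rs.
Qed.

Lemma projective_pair P Q :
  projective P -> projective Q -> projective (dsum P Q).
Proof.
move=> Pproj Qproj B C p f psurj.
have [i1 i1E] : exists i : {linear P -> dsum P Q}, forall x, i x = (x, 0).
  by apply: linear_exists => a u v; congr pair; rewrite /= scaler0 addr0.
have [i2 i2E] : exists i : {linear Q -> dsum P Q}, forall x, i x = (0, x).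
  by apply: linear_exists => a u v; congr pair; rewrite /= scaler0 addr0.
have [g gP] := Pproj B C p (f \o i1 : {linear P -> C}) psurj.
have [h hP] := Qproj B C p (f \o i2 : {linear Q -> C}) psurj.
have [k kP] := linear_copair g h.
exists k => -[x y]; rewrite kP linearD /= gP hP /= i1E i2E -linearD.
by congr (f _); congr pair; rewrite /= ?addr0 ?add0r.
Qed.

(** [ext1_zero L Y] says that [Ext^1(L, Y) = 0], and [ext_zero i L Y] says that
    [Ext^(i+1)(L, Y) = 0]. *)
Definition ext1_zero L Y : Prop :=
  forall A B (i : {linear A -> B}) (p : {linear B -> L}), short_exact i p ->
  forall h : {linear A -> Y}, exists g : {linear B -> Y}, forall a, g (i a) = h a.

Fixpoint ext_zero (n : nat) L Y : Prop :=
  if n is n'.+1 then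
    forall K P (i : {linear K -> P}) (p : {linear P -> L}),
      short_exact i p -> projective P -> ext_zero n' K Y
  else ext1_zero L Y.

(** A lift [P -> B] of [p] induces [K -> A] and exhibits any extension [B] of [L] by [A] as a
    pushout of [P]. Hence one projective presentation tests all extensions of [L]. *)
Lemma ext1_zero_presentation L Y K P (i : {linear K -> P}) (p : {linear P -> L}) :
    short_exact i p -> projective P ->
    (forall h : {linear K -> Y},
       exists g : {linear P -> Y}, forall k, g (i k) = h k) ->
  ext1_zero L Y.
Proof.
move=> ip Pproj ext A B j q jq h.
have [iinj psurj ipP] := ip; have [jinj qsurj jqP] := jq.
have [s sP] := Pproj B L q p qsurj.
have [|s' s'P] := linear_factor_inj (i := j) (f := s \o i : {linear K -> B}) jinj.
  by move=> k; apply/jqP; rewrite /= sP (short_exact0 ip).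
have [g gP] := ext (h \o s' : {linear K -> Y}).
have [d dE] := linear_copair s j; have [f fE] := linear_copair g h.
(* [d] presents [B] as a quotient of [P + A]. Its kernel consists of the pairs [(i k, - s' k)], and
   [f] vanishes on them. *)
have [b|[x a] /=|u uP] := linear_factor_surj (p := d) (f := f).
- have [x px] := psurj (q b).
  have [a ja] : exists a, j a = b - s x by apply/jqP; rewrite linearB sP px subrr.
  by exists (x, a); rewrite dE /= ja addrC subrK.
- rewrite dE fE /= => e.
  have [k kE] : exists k, i k = x.
    by apply/ipP; rewrite -sP -[RHS](linear0 q) -e linearD (short_exact0 jq) addr0.
  rewrite -kE gP /= -linearD (_ : s' k + a = 0) ?linear0 //; apply: jinj.
  by rewrite linearD s'P /= kE e linear0.
exists u => a; have := uP (0, a); rewrite dE fE /= !linear0 !add0r.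
by [].
Qed.

(** The obstruction to lifting [f] is the pullback of the sequence along [f], an extension of [L] by
    [A]; a retraction onto [A] removes it. *)
Lemma ext1_zero_lift L A B C (i : {linear A -> B}) (p : {linear B -> C}) :
    short_exact i p -> ext1_zero L A ->
  forall f : {linear L -> C}, exists g : {linear L -> B}, forall x, p (g x) = f x.
Proof.
move=> [iinj psurj ip] ext f.
have [d dE] := linear_copair (f : {linear L -> C}) (\- p : {linear B -> C}).
have Ed (k : kermod d) : f (kerval d k).1 = p (kerval d k).2.
  by apply/eqP; rewrite -subr_eq0 -[_ - _]dE kervalP.
have [j0 j0E] : exists j0 : {linear A -> dsum L B}, forall a, j0 a = (0, i a).
  by apply: linear_exists => a u v; rewrite linearP; congr pair; rewrite /= scaler0 addr0.
have [|j jE] := linear_factor_inj (f := j0) (@kerval_inj _ _ _ d).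
  move=> a; apply: kerval_ex; rewrite j0E dE /= linear0 add0r.
  by apply/eqP; rewrite oppr_eq0; apply/eqP/ip; exists a.
have [q qE] : exists q : {linear kermod d -> L}, forall k, q k = (kerval d k).1.
  by apply: linear_exists => a u v; rewrite !linearP.
have jq : short_exact j q.
  split=> [a b e|x|k].
  - by apply: iinj; have := congr1 (kerval d) e; rewrite !jE !j0E => -[].
  - have [b e] := psurj (f x); have [|k kE] := kerval_ex (f := d) (u := (x, b)).
      by rewrite dE /= e subrr.
    by exists k; rewrite qE kE.
  split=> [|[a <-]]; last by rewrite qE jE j0E.
  rewrite qE => e; have := Ed k; rewrite e linear0 => /esym/ip[a ia].
  by exists a; apply: (kerval_inj (f := d)); rewrite jE j0E ia -e -surjective_pairing.
have [r rP] := ext _ _ _ _ jq idfun.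
have [_ jsurj jqP] := jq.
(* The projection of the pullback to [B], corrected by [i] after the retraction [r], vanishes on [A]
   and so descends to [L]. *)
have [|g gP] := linear_factor_surj
    (f := ((snd : {linear dsum L B -> B}) \o @kerval _ _ _ d) \- (i \o r)) jsurj.
  by move=> k /jqP[a <-]; rewrite /= rP jE j0E /= subrr.
exists g => x; have [k <-] := jsurj x; rewrite gP /= linearB -Ed -qE.
by rewrite (_ : p (i _) = 0) ?subr0 //; apply/ip; exists (r k).
Qed.

(* The connecting maps [Ext^1(L, Y'') -> Ext^2(L, Y') = Ext^1(K, Y')], in both
   directions of exactness. *)
Lemma ext1_zero_quot L K P Y' Y Y'' (i : {linear K -> P}) (p : {linear P -> L})
    (j : {linear Y' -> Y}) (q : {linear Y -> Y''}) :
    short_exact i p -> projective P -> short_exact j q ->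
  ext1_zero L Y -> ext1_zero K Y' -> ext1_zero L Y''.
Proof.
move=> ip Pproj jq extY extY'; apply: (ext1_zero_presentation ip) => // h.
have [h' h'P] := ext1_zero_lift jq extY' h.
have [g gP] := extY _ _ _ _ ip h'.
by exists (q \o g : {linear P -> Y''}) => k /=; rewrite gP h'P.
Qed.

Lemma ext1_zero_sub L K K2 P P2 Y' Y Y''
    (i : {linear K -> P}) (p : {linear P -> L})
    (i2 : {linear K2 -> P2}) (p2 : {linear P2 -> K})
    (j : {linear Y' -> Y}) (q : {linear Y -> Y''}) :
    short_exact i p -> projective P -> short_exact i2 p2 -> projective P2 ->
    short_exact j q ->
  ext1_zero L Y'' -> ext1_zero K Y -> ext1_zero K Y'.
Proof.
move=> ip Pproj ip2 P2proj jq extY'' extY.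
have [jinj qsurj jqP] := jq; have [_ p2surj ip2P] := ip2.
apply: (ext1_zero_presentation ip2) => // h.
have [g gP] := extY _ _ _ _ ip2 (j \o h : {linear K2 -> Y}).
have [|u uP] := linear_factor_surj (f := q \o g : {linear P2 -> Y''}) p2surj.
  move=> x /ip2P[k <-] /=; rewrite gP /=; exact: (short_exact0 jq).
(* [u] measures how far [g] is from landing in [Y']. Extending [u] over [P] and lifting to [Y] gives
   a correction of [g] that is zero on [K2]. *)
have [v vP] := extY'' _ _ _ _ ip u.
have [w wP] := Pproj _ _ q v qsurj.
have [|f fP] := linear_factor_inj
    (f := g \- (w \o (i \o p2)) : {linear P2 -> Y}) jinj.
  by move=> x; apply/jqP; rewrite /= linearB wP vP uP subrr.
exists f => k; apply: jinj; rewrite fP /= gP /=.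
by rewrite (short_exact0 ip2) !linear0 addr0.
Qed.

(** The preimage [Q] of [A] in an extension [P] of [B] cuts the problem in two: [Q] is an extension
    of [A] by [K], and [P] is an extension of [C] by [Q]. *)
Lemma ext1_zero_mid Y A B C (i : {linear A -> B}) (p : {linear B -> C}) :
  short_exact i p -> ext1_zero A Y -> ext1_zero C Y -> ext1_zero B Y.
Proof.
move=> [iinj psurj ip] extA extC K P j q [jinj qsurj jq] h.
pose Q := kermod (p \o q : {linear P -> C}); pose v : {linear Q -> P} := kerval _.
have [|j' j'E] := linear_factor_inj (i := v) (f := j) (@kerval_inj _ _ _ _).
  by move=> k; apply: kerval_ex; rewrite /= (_ : q (j k) = 0) ?linear0 //; apply/jq; exists k.
have [|q' q'E] := linear_factor_inj (i := i) (f := q \o v : {linear Q -> B}) iinj.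
  by move=> k; apply/ip; exact: (kervalP k).
have jq' : short_exact j' q'.
  split=> [k k' e|a|u].
  - by apply: jinj; rewrite -!j'E e.
  - have [x qx] := qsurj (i a); have [|k kE] := kerval_ex (f := p \o q : {linear P -> C}) (u := x).
      by rewrite /= qx; apply/ip; exists a.
    by exists k; apply: iinj; rewrite q'E /= /v kE.
  have -> : q' u = 0 <-> q (v u) = 0.
    by have := q'E u => /= <-; split=> [->|e]; [exact: linear0 | apply: iinj; rewrite e linear0].
  split=> [/jq[k jk]|[k <-]]; last by rewrite j'E; apply/jq; exists k.
  by exists k; apply: (kerval_inj (f := p \o q : {linear P -> C})); rewrite -/v j'E.
have [g gP] := extA _ _ _ _ jq' h.
have vC : short_exact v (p \o q : {linear P -> C}).
  apply: ker_short_exact => c; have [b <-] := psurj c; have [x <-] := qsurj b.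
  by exists x.
have [f fP] := extC _ _ _ _ vC g.
by exists f => k; rewrite -j'E fP gP.
Qed.

Lemma projective_ext1_zero P Y : projective P -> ext1_zero P Y.
Proof.
move=> Pproj A B i p [iinj psurj ip] h.
have [s sP] := Pproj _ _ p idfun psurj.
have [|r rP] := linear_factor_inj (f := idfun \- (s \o p) : {linear B -> B}) iinj.
  by move=> b; apply/ip; rewrite /= linearB sP subrr.
exists (h \o r : {linear B -> Y}) => a /=; congr (h _); apply: iinj.
have /ip pia : exists a', i a' = i a by exists a.
by rewrite rP /= pia !linear0 addr0.
Qed.

Lemma kernel_projective K Q P (i : {linear K -> Q}) (p : {linear Q -> P}) :
  short_exact i p -> projective Q -> projective P -> projective K.
Proof.
move=> ip Qproj Pproj; have [r rP] : exists r : {linear Q -> K}, forall k, r (i k) = k.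
  have ext := @projective_ext1_zero _ K Pproj.
  exact: (ext _ _ _ _ ip idfun).
exact: (projective_retract rP).
Qed.

Lemma projective_ext_zero n P Y : projective P -> ext_zero n P Y.
Proof.
elim: n P => [|n IHn] P Pproj; first exact: projective_ext1_zero.
by move=> K Q i p ip Qproj; apply: IHn; exact: kernel_projective ip Qproj Pproj.
Qed.

Lemma ext_zero_iso n L L' Y (f : {linear L -> L'}) (g : {linear L' -> L}) :
  cancel f g -> cancel g f -> ext_zero n L Y -> ext_zero n L' Y.
Proof.
move=> fK gK extL.
have ipg K P (i : {linear K -> P}) (p : {linear P -> L'}) :
    short_exact i p -> short_exact i (g \o p : {linear P -> L}).
  move=> [iinj psurj ip]; split=> // [c|b] /=.
    by have [b pb] := psurj (f c); exists b; rewrite /= pb fK.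
  rewrite -ip; split=> [e|->]; last by rewrite linear0.
  by rewrite -[p b]gK e linear0.
case: n extL => [|n] extL.
  by move=> A B i p /ipg; exact: extL.
by move=> K P i p /ipg; exact: extL.
Qed.

Lemma schanuel L K P K' P' (i : {linear K -> P}) (p : {linear P -> L})
    (i' : {linear K' -> P'}) (p' : {linear P' -> L}) :
    short_exact i p -> projective P -> short_exact i' p' -> projective P' ->
  exists (f : {linear dsum K P' -> dsum K' P})
         (g : {linear dsum K' P -> dsum K P'}), cancel f g /\ cancel g f.
Proof.
move=> ip Pproj ip' P'proj.
have half (M N M' N' : lmodType R) (u : {linear M -> N}) (q : {linear N -> L})
    (u' : {linear M' -> N'}) (q' : {linear N' -> L})
    (t : {linear N -> N'}) (t' : {linear N' -> N}) :
    short_exact u q -> short_exact u' q' ->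
    (forall x, q' (t x) = q x) -> (forall x, q (t' x) = q' x) ->
  exists f : {linear dsum M N' -> dsum M' N}, forall x,
    (f x).2 = u x.1 + t' x.2 /\ u' (f x).1 = x.2 - t ((f x).2).
  move=> [uinj qsurj uq] [uinj' qsurj' uq'] qt qt'.
  have [f2 f2E] := linear_copair u t'.
  have [s sE] : exists s : {linear dsum M N' -> N'}, forall x, s x = x.2 - t (f2 x).
    by apply: linear_exists => a x y; rewrite !linearP /= scalerDr addrACA.
  have [|f1 f1E] := linear_factor_inj (f := s) uinj'.
    move=> x; apply/uq'; rewrite sE linearB qt f2E linearD qt'.
    by rewrite (_ : q (u x.1) = 0) ?add0r ?subrr //; apply/uq; exists x.1.
  have [f fE] := linear_pair f1 f2; exists f => x; rewrite fE /= f1E sE f2E.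
  by split.
have [t tE] := Pproj _ _ p' p (let: And3 _ e _ := ip' in e).
have [t' t'E] := P'proj _ _ p p' (let: And3 _ e _ := ip in e).
have [f fP] := half _ _ _ _ _ _ _ _ t t' ip ip' tE t'E.
have [g gP] := half _ _ _ _ _ _ _ _ t' t ip' ip t'E tE.
have [iinj _ _] := ip; have [iinj' _ _] := ip'.
exists f, g; split=> x.
  have [f2 f1] := fP x; have [g2 g1] := gP (f x).
  have e2 : (g (f x)).2 = x.2 by rewrite g2 f1 subrK.
  rewrite [LHS]surjective_pairing [RHS]surjective_pairing e2; congr pair.
  by apply: iinj; rewrite g1 e2 f2 addrK.
have [g2 g1] := gP x; have [f2 f1] := fP (g x).
have e2 : (f (g x)).2 = x.2 by rewrite f2 g1 subrK.
rewrite [LHS]surjective_pairing [RHS]surjective_pairing e2; congr pair.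
by apply: iinj'; rewrite f1 e2 g2 addrK.
Qed.

Lemma fst_snd_short_exact A B : exists (i : {linear A -> dsum A B})
  (p : {linear dsum A B -> B}), short_exact i p.
Proof.
have [i iE] : exists i : {linear A -> dsum A B}, forall x, i x = (x, 0).
  by apply: linear_exists => a u v; congr pair; rewrite /= scaler0 addr0.
exists i, (snd : {linear dsum A B -> B}); split=> [a b|b|[a b]].
- by rewrite !iE => -[].
- by exists (0, b).
by split=> /= [->|[c]]; [exists a; rewrite iE | rewrite iE => -[]].
Qed.

End ExtVanishing.

(** * Independence of the presentation, and comparison with [Ext] *)

Section Resolutions.
Variable R : comNzRingType.
Implicit Types A B C K L M N P Q U W Y Z : lmodType R.

Definition free_lmod (X : choiceType) : lmodType R := freemod R X.
Definition syzygy_lmod L : lmodType R := syzygy L.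

Lemma freemod_short_exact L :
  exists (i : {linear syzygy_lmod L -> free_lmod L}) (p : {linear free_lmod L -> L}),
    [/\ short_exact i p, i =1 val & p =1 @freecover R L].
Proof.
have [i iE] : exists i : {linear syzygy_lmod L -> free_lmod L}, i =1 val.
  by apply: linear_exists => a u v; rewrite linearP.
exists i, (@freecover R L); split=> //; split=> [u v|x|c].
- by rewrite !iE => /val_inj.
- by exists (freebasis x); exact: (freelift_basis id).
split=> [/eqP c0|[u <-]]; last by rewrite iE; exact/eqP/(valP u).
by exists (exist _ c c0); rewrite iE.
Qed.

Lemma freemod_span (X : choiceType) (V : lmodType R) (f g : {linear free_lmod X -> V}) :
  (forall x, f (freebasis x) = g (freebasis x)) -> f =1 g.
Proof.
move=> fg.
suff span0 (s : seq X) (c : free_lmod X) :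
    (forall x, val c x != 0 -> x \in s) -> f c = g c.
  move=> c; have /asboolP/finite_seqP[s sE] := valP c.
  apply: (span0 s) => x cx.
  by have : [set` s] x by rewrite -sE.
elim: s c => [|x s IHs] c cs.
  suff -> : c = 0 by rewrite !linear0.
  by apply: val_inj; apply/funext => y; apply/eqP; apply: contraT => /cs.
pose a : R := val c x.
pose e : free_lmod X := freebasis x.
have [c' c'E] : exists c' : free_lmod X, c' = c - a *: e by eexists.
suff IHc : f c' = g c'.
  have -> : c = c' + a *: e by rewrite c'E subrK.
  by rewrite !linearD IHc !linearZ /= fg.
have valE y : val c' y = val c y - a * (y == x)%:R by rewrite c'E.
apply: IHs => y; rewrite valE; case: (eqVneq y x) => [->|yx].
  by rewrite mulr1 subrr eqxx.
by rewrite mulr0 subr0 => /cs; rewrite inE (negPf yx).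
Qed.

Lemma freemod_projective (X : choiceType) : projective (free_lmod X).
Proof.
move=> B C p f psurj.
pose g := freelift (fun x : X => sval (cid (psurj (f (freebasis x))))).
have [g' g'E] : exists g' : {linear free_lmod X -> B}, g' =1 g.
  exact/linear_exists/freelift_linear.
exists g'; apply: (freemod_span (f := p \o g') (g := f)) => x /=.
by rewrite g'E /g freelift_basis; case: (cid _).
Qed.

Lemma presentation L : exists (K P : lmodType R) (i : {linear K -> P})
  (p : {linear P -> L}), short_exact i p /\ projective P.
Proof.
have [i [p [ip _ _]]] := freemod_short_exact L.
by exists (syzygy_lmod L), (free_lmod L), i, p; split=> //; exact: freemod_projective.
Qed.

Lemma dsum_swap L M : exists f : {linear dsum L M -> dsum M L}, forall x, f x = (x.2, x.1).
Proof. by apply: linear_exists. Qed.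

Lemma ext_zero_swap n L M Y : ext_zero n (dsum L M) Y -> ext_zero n (dsum M L) Y.
Proof.
have [f fE] := dsum_swap L M; have [g gE] := dsum_swap M L.
by apply: (ext_zero_iso (f := f) (g := g)) => -[x y]; rewrite fE gE.
Qed.

Lemma ext1_zero_dsuml L M Y : ext1_zero (dsum L M) Y -> ext1_zero L Y.
Proof.
move=> ext A B i p [iinj psurj ip] h.
have [j jE] : exists j : {linear A -> dsum B M}, forall a, j a = (i a, 0).
  by apply: linear_exists => a u v; rewrite linearP; congr pair; rewrite /= scaler0 addr0.
have [q qE] : exists q : {linear dsum B M -> dsum L M}, forall x, q x = (p x.1, x.2).
  by apply: linear_exists => a u v; rewrite linearP.
have jq : short_exact j q.
  split=> [a b|[c m]|[b m]].
  - by rewrite !jE => -[/iinj].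
  - by have [b <-] := psurj c; exists (b, m); rewrite qE.
  rewrite qE /=; split=> [[/ip[a <-] ->]|[a]]; first by exists a; rewrite jE.
  by rewrite jE => -[<- <-]; congr pair; apply/ip; exists a.
have [g gP] := ext _ _ _ _ jq h.
have [k kE] : exists k : {linear B -> dsum B M}, forall b, k b = (b, 0).
  by apply: linear_exists => a u v; congr pair; rewrite /= scaler0 addr0.
by exists (g \o k : {linear B -> Y}) => a; rewrite /= kE -jE gP.
Qed.

(** A joint induction is needed: Schanuel's lemma compares presentations only up to projective
    summands, which additivity in the same degree cancels, while additivity in the next degree uses
    independence of the presentation, applied to a sum of presentations. *)
Lemma ext_zero_dsum_presentation n Y :
  (forall L M, ext_zero n (dsum L M) Y <-> ext_zero n L Y /\ ext_zero n M Y)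
  /\ (forall L K P (i : {linear K -> P}) (p : {linear P -> L}),
        short_exact i p -> projective P -> ext_zero n.+1 L Y <-> ext_zero n K Y).
Proof.
have step k : (forall L M, ext_zero k (dsum L M) Y <-> ext_zero k L Y /\ ext_zero k M Y) ->
    forall L K P (i : {linear K -> P}) (p : {linear P -> L}),
      short_exact i p -> projective P -> ext_zero k.+1 L Y <-> ext_zero k K Y.
  move=> prodE L K P i p ip Pproj; split=> [ext|extK K' P' i' p' ip' P'proj].
    exact: ext ip Pproj.
  have [f [g [fK gK]]] := schanuel ip Pproj ip' P'proj.
  have /prodE[] // : ext_zero k (dsum K' P) Y.
  apply: (ext_zero_iso fK gK); apply/prodE; split=> //.
  exact: projective_ext_zero.
elim: n => [|n [IHprod IHpres]]; last first.
  suff prodE : forall L M, ext_zero n.+1 (dsum L M) Y <-> ext_zero n.+1 L Y /\ ext_zero n.+1 M Y.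
    by split; [exact: prodE | exact: step].
  move=> L M.
  have [K [P [i [p [ip Pproj]]]]] := presentation L.
  have [K' [P' [i' [p' [ip' P'proj]]]]] := presentation M.
  have [j [q jq]] := short_exact_pair ip ip'.
  rewrite (IHpres _ _ _ _ _ ip) // (IHpres _ _ _ _ _ ip') //.
  by rewrite (IHpres _ _ _ _ _ jq) //; exact: projective_pair.
suff prodE : forall L M, ext_zero 0 (dsum L M) Y <-> ext_zero 0 L Y /\ ext_zero 0 M Y.
  by split; [exact: prodE | exact: step].
move=> L M; split=> [ext|[extL extM]].
  split; first exact: ext1_zero_dsuml ext.
  exact: (ext1_zero_dsuml (ext_zero_swap (n := 0) ext)).
by have [i [p ip]] := fst_snd_short_exact L M; exact: ext1_zero_mid ip extL extM.
Qed.

Lemma ext_zero_dsum n L M Y :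
  ext_zero n (dsum L M) Y <-> ext_zero n L Y /\ ext_zero n M Y.
Proof. exact: (ext_zero_dsum_presentation n Y).1. Qed.

Lemma ext_zero_syzygy n Y L K P (i : {linear K -> P}) (p : {linear P -> L}) :
  short_exact i p -> projective P -> ext_zero n.+1 L Y <-> ext_zero n K Y.
Proof. exact: (ext_zero_dsum_presentation n Y).2. Qed.

Lemma ext_zero_dsumr n L Y Z :
  ext_zero n L (dsum Y Z) <-> ext_zero n L Y /\ ext_zero n L Z.
Proof.
elim: n L => [|n IHn] L /=; last first.
  split=> [ext|[extY extZ] K P i p ip Pproj].
    by split=> K P i p ip Pproj; have /IHn[] := ext _ _ _ _ ip Pproj.
  by apply/IHn; split; [exact: extY ip Pproj | exact: extZ ip Pproj].
split=> [ext|[extY extZ] A B i p ip h].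
  split=> A B i p ip h.
    have [h' h'E] := linear_pair h (\0 : {linear A -> Z}).
    have [g gP] := ext _ _ _ _ ip h'.
    by exists ((fst : {linear dsum Y Z -> Y}) \o g) => a /=; rewrite gP h'E.
  have [h' h'E] := linear_pair (\0 : {linear A -> Y}) h.
  have [g gP] := ext _ _ _ _ ip h'.
  by exists ((snd : {linear dsum Y Z -> Z}) \o g) => a /=; rewrite gP h'E.
have [g gP] := extY _ _ _ _ ip ((fst : {linear dsum Y Z -> Y}) \o h : {linear A -> Y}).
have [g' g'P] := extZ _ _ _ _ ip ((snd : {linear dsum Y Z -> Z}) \o h : {linear A -> Z}).
have [k kE] := linear_pair g g'; exists k => a; rewrite kE gP g'P /=.
by rewrite -surjective_pairing.
Qed.

Lemma quomod_eq0 (V : lmodType R) (W : submodClosed V) (v : V) :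
  (\pi_(quomod W)%qT v == 0) = (v \in W).
Proof.
have -> : 0 = \pi_(quomod W)%qT (0 : V) by rewrite raddf0.
by rewrite -(@Quotient.idealrBE V (submod_pred W)) subr0.
Qed.

Lemma ext_zero_itersyzygy n M Y : ext_zero n M Y <-> ext1_zero (itersyzygy n M) Y.
Proof.
elim: n M => [|n IHn] M //.
have [i [p [ip _ _]]] := freemod_short_exact M.
rewrite (ext_zero_syzygy _ _ ip); last exact: freemod_projective.
by rewrite IHn /itersyzygy iterSr.
Qed.

(** A cocycle on [F_(n+1)] is a map on the syzygy of [itersyzygy n M], and it is a coboundary
    exactly when this map extends to [F_n]. This is the test for [Ext^1] of [itersyzygy n M] on its
    canonical cover. *)
Lemma Ext_eq0S n M Y : Ext_eq0 n.+1 M Y <-> ext_zero n M Y.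
Proof.
rewrite ext_zero_itersyzygy; set L := itersyzygy n M.
have [i [p [ip iE pE]]] := freemod_short_exact L.
have [i1 [p1 [ip1 i1E p1E]]] := freemod_short_exact (syzygy_lmod L).
have [i2 [p2 [ip2 i2E p2E]]] := freemod_short_exact (syzygy_lmod (syzygy_lmod L)).
have [_ p1surj ip1P] := ip1; have [_ p2surj _] := ip2.
have dE (c : resol n.+1 M) : resol_diff c = i (p1 c) by rewrite iE p1E.
have dE1 (c : resol n.+2 M) : resol_diff c = i1 (p2 c) by rewrite i1E p2E.
split=> [ext|ext e].
  apply: (ext1_zero_presentation ip) => [|h]; first exact: freemod_projective.
  pose f : resol n.+1 M -> Y := h \o p1.
  have fZ : f \in @ext_cocycle R n.+1 M Y.
    apply/asboolP; split; first by move=> a u v; rewrite /f linearP.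
    by apply/funext => c /=; rewrite /f dE1 /= (short_exact0 ip1) linear0.
  have /eqP := ext (\pi_(Ext n.+1 M Y)%qT (exist _ f fZ)).
  rewrite quomod_eq0 => /asboolP[g /linear_exists[g' g'E] fE].
  exists g' => k; have [c <-] := p1surj k.
  by rewrite g'E -dE -[LHS]/((g \o @resol_diff R n M) c) -fE.
rewrite -[e]reprK; apply/eqP; rewrite quomod_eq0; move: (repr e) => F.
have /asboolP[flin fd] := valP F.
have [f fE] := linear_exists flin.
have [|h hP] := linear_factor_surj (p := p1) (f := f) p1surj.
  move=> c /ip1P[k <-]; have [c2 <-] := p2surj k; rewrite -dE1 fE.
  exact: (congr1 (fun u => u c2) fd).
have [g gP] := ext _ _ _ _ ip h.
apply/asboolP; exists g; first by move=> a u v; rewrite linearP.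
by apply/funext => c; rewrite /= dE gP hP fE.
Qed.

End Resolutions.

(** * Noetherian modules *)

Section Spans.
Variable R : comNzRingType.
Implicit Types U V W : lmodType R.

Lemma lspan_mem V (A : set V) a : A a -> a \in lspan A.
Proof. by move=> Aa; apply/asboolP => W _; apply. Qed.

Lemma lspan_min V (A : set V) (W : {pred V}) :
  submod_closed W -> (forall a, A a -> a \in W) -> {subset lspan A <= W}.
Proof. by move=> Wsub AW x /asboolP; apply. Qed.

Lemma lspan_ind V (A : set V) (P : V -> Prop) :
    P 0 -> (forall a u v, P u -> P v -> P (a *: u + v)) -> (forall a, A a -> P a) ->
  forall v, v \in lspan A -> P v.
Proof.
move=> P0 Plin PA v Av; suff : v \in (fun v => `[< P v >]) by move/asboolP.
apply: lspan_min Av => [|a /PA Pa]; last exact/asboolP.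
by split=> [|a u w /asboolP Pu /asboolP Pw]; apply/asboolP => //; exact: Plin.
Qed.

Lemma lspan_subset V (A B : set V) : A `<=` B -> {subset lspan A <= lspan B}.
Proof.
by move=> AB; apply: lspan_min => [|a /AB]; [exact: lspan_submod | exact: lspan_mem].
Qed.

Lemma lspan_image U V (f : {linear U -> V}) (A : set U) v :
  v \in lspan (f @` A) -> exists2 u, u \in lspan A & f u = v.
Proof.
move: v; apply: lspan_ind => [|a _ _ [u uA <-] [u' uA' <-]|_ [a Aa <-]].
- by exists 0; rewrite ?linear0 ?rpred0.
- by exists (a *: u + u'); rewrite ?linearP ?rpredD ?rpredZ.
by exists a => //; exact: lspan_mem.
Qed.

Lemma lspan_fin V (A : set V) v :
  v \in lspan A -> exists2 s : seq V, (forall a, a \in s -> A a) & v \in lspan [set` s].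
Proof.
move: v; apply: lspan_ind => [|a u v [s sA us] [t tA vt]|a Aa].
- by exists [::] => [a|]; [rewrite in_nil | exact: rpred0].
- exists (s ++ t); first by move=> b; rewrite mem_cat => /orP[/sA|/tA].
  apply: rpredD; first apply: rpredZ.
    by apply: lspan_subset us => b /= bs; rewrite mem_cat bs.
  by apply: lspan_subset vt => b /= bs; rewrite mem_cat bs orbT.
exists [:: a]; last by apply: lspan_mem; rewrite /= inE.
by move=> b; rewrite inE => /eqP->.
Qed.

Lemma lspan_seq_fin V (A : set V) (s : seq V) :
    (forall v, v \in s -> v \in lspan A) ->
  exists2 t : seq V, (forall a, a \in t -> A a) &
    forall v, v \in s -> v \in lspan [set` t].
Proof.
elim: s => [|v s IHs] sA; first by exists [::].
have [w ws|t tA st] := IHs; first by apply: sA; rewrite inE ws orbT.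
have [t' tA' vt'] := lspan_fin (sA v (mem_head _ _)).
exists (t' ++ t) => [a|w]; first by rewrite mem_cat => /orP[/tA'|/tA].
rewrite inE => /orP[/eqP->|/st wt]; [move: vt' | move: wt].
  by apply: lspan_subset => b /= bt; rewrite mem_cat bt.
by apply: lspan_subset => b /= bt; rewrite mem_cat bt orbT.
Qed.

Definition fpow n V : lmodType R := {ffun 'I_n -> V}.

Fact lincomb_subproof n V (f : 'I_n -> V) :
  exists g : {linear fpow n R^o -> V},
    forall c, g c = \sum_(i < n) (c i : R) *: f i.
Proof.
apply: linear_exists => a c d; rewrite scaler_sumr -big_split /=.
by apply: eq_bigr => i _; rewrite !ffunE scalerDl scalerA.
Qed.

Definition lincomb n V (f : 'I_n -> V) : {linear fpow n R^o -> V} :=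
  sval (cid (lincomb_subproof f)).

Lemma lincombE n V (f : 'I_n -> V) c : lincomb f c = \sum_(i < n) (c i : R) *: f i.
Proof. exact: svalP (cid (lincomb_subproof f)) c. Qed.

Definition fpow_delta n (i : 'I_n) : fpow n R^o := [ffun j => (j == i)%:R].

Lemma lincomb_delta n V (f : 'I_n -> V) i : lincomb f (fpow_delta i) = f i.
Proof.
rewrite lincombE (bigD1 i) //= ffunE eqxx scale1r big1 ?addr0 // => j /negPf ji.
by rewrite ffunE ji scale0r.
Qed.

Lemma lincomb_fpow_delta n (c : fpow n R^o) : lincomb (@fpow_delta n) c = c.
Proof.
apply/ffunP => j; rewrite lincombE sum_ffunE (bigD1 j) //= !ffunE eqxx.
rewrite big1 ?addr0 => [|i /negPf ij]; first exact: mulr1.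
by rewrite !ffunE eq_sym ij; exact: mulr0.
Qed.

Lemma fpow_projective n : projective (fpow n R^o).
Proof.
move=> B C p f psurj.
pose b i := sval (cid (psurj (f (@fpow_delta n i)))).
exists (lincomb b) => c; rewrite lincombE -[in RHS](lincomb_fpow_delta c) lincombE.
rewrite !linear_sum; apply: eq_bigr => i _; rewrite !linearZ /=; congr (_ *: _).
by rewrite /b; case: (cid _).
Qed.

Lemma regular_projective : projective (R^o : lmodType R).
Proof.
have [s sE] : exists s : {linear R^o -> fpow 1 R^o}, forall a, s a = [ffun _ => a].
  by apply: linear_exists => a u v; apply/ffunP => j; rewrite !ffunE.
have [r rE] : exists r : {linear fpow 1 R^o -> R^o}, forall c, r c = c ord0.
  by apply: linear_exists => a u v; rewrite !ffunE.
apply: (projective_retract (s := s) (r := r)); last exact: fpow_projective.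
by move=> x; rewrite rE sE ffunE.
Qed.

Lemma lincomb_mem n V (f : 'I_n -> V) (W : {pred V}) : submod_closed W ->
  (forall i, f i \in W) -> forall c, lincomb f c \in W.
Proof.
(* [W] is a bare predicate; its span, contained in it, carries the closure structure that the
   [rpred] lemmas need. *)
move=> Wsub fW c; pose W' := lspan [set x | x \in W].
have Ww x : x \in W' -> x \in W by exact: lspan_min.
apply: Ww; rewrite lincombE; apply: rpred_sum => i _; apply: rpredZ.
by apply: lspan_mem => /=.
Qed.

Lemma lspan_lincomb V (s : seq V) v :
  v \in lspan [set` s] -> exists c, v = lincomb (fun i : 'I_(size s) => s`_i) c.
Proof.
move: v; apply: lspan_ind => [|a _ _ [c ->] [d ->]|a /(nthP 0)[i si <-]].
- by exists 0; rewrite linear0.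
- by exists (a *: c + d); rewrite linearP.
by exists (fpow_delta (Ordinal si)); rewrite lincomb_delta.
Qed.

Lemma fingenP V : fingen V <->
  exists n (f : 'I_n -> V), forall v, exists c, lincomb f c = v.
Proof.
split=> [[s sV]|[n [f fV]]].
  by exists (size s), (fun i => s`_i) => v; have [c ->] := lspan_lincomb (sV v); exists c.
exists (codom f) => v; have [c <-] := fV v.
apply: lincomb_mem => [|i]; first exact: lspan_submod.
by apply: lspan_mem => /=; exact: codom_f.
Qed.

Lemma fingen_dsum U V : fingen U -> fingen V -> fingen (dsum U V).
Proof.
move=> [s sU] [t tV]; exists ([seq (u, 0) | u <- s] ++ [seq (0, v) | v <- t]) => -[u v].
set W := lspan _.
have [i iE] : exists i : {linear U -> dsum U V}, forall x, i x = (x, 0).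
  by apply: linear_exists => a x y; congr pair; rewrite /= scaler0 addr0.
have [j jE] : exists j : {linear V -> dsum U V}, forall x, j x = (0, x).
  by apply: linear_exists => a x y; congr pair; rewrite /= scaler0 addr0.
have -> : ((u, v) : dsum U V) = i u + j v.
  by rewrite iE jE; congr pair; rewrite /= ?addr0 ?add0r.
apply: rpredD; [move: u (sU u) | move: v (tV v)]; apply: lspan_ind.
- by rewrite linear0 rpred0.
- by move=> a x y xW yW; rewrite linearP; apply: rpredD => //; exact: rpredZ.
- by move=> a /= sa; rewrite iE; apply: lspan_mem; rewrite /= mem_cat map_f.
- by rewrite linear0 rpred0.
- by move=> a x y xW yW; rewrite linearP; apply: rpredD => //; exact: rpredZ.
by move=> a /= ta; rewrite jE; apply: lspan_mem; rewrite /= mem_cat map_f ?orbT.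
Qed.

Lemma fingen_surj U V (f : {linear U -> V}) :
  (forall v, exists u, f u = v) -> fingen U -> fingen V.
Proof.
move=> fsurj /fingenP[n [g gU]]; apply/fingenP; exists n, (f \o g) => v.
have [u <-] := fsurj v; have [c <-] := gU u; exists c.
by rewrite !lincombE linear_sum; apply: eq_bigr => i _; rewrite linearZ.
Qed.

Lemma lincomb_lift n V (f : 'I_n.+1 -> V) i c :
  lincomb f c = (c i : R) *: f i + lincomb (f \o lift i) [ffun j => c (lift i j)].
Proof.
rewrite !lincombE (bigD1_ord i) //=; congr (_ + _).
by apply: eq_bigr => j _; rewrite ffunE.
Qed.

Definition noetherian_mod V : Prop :=
  forall W : {pred V}, submod_closed W -> exists s : seq V, W =i lspan [set` s].

Lemma noetherian_mod_ext U V W (i : {linear U -> V}) (p : {linear V -> W}) :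
    (forall v, p v = 0 -> exists u, i u = v) ->
  noetherian_mod U -> noetherian_mod W -> noetherian_mod V.
Proof.
move=> ip Un Wn Z Zsub; have [Z0 Zlin] := Zsub.
have ZP x : x \in Z -> x \in lspan [set y | y \in Z] by move=> ?; exact: lspan_mem.
have PZ x : x \in lspan [set y | y \in Z] -> x \in Z by exact: lspan_min.
have [|s sZ] := Un (fun u => i u \in Z).
  split=> [|a u v iu iv]; rewrite unfold_in; first by rewrite linear0.
  by rewrite linearP; exact: Zlin.
have [|t tZ] := Wn (fun w => `[< exists2 v, v \in Z & p v = w >]).
  split=> [|a _ _ /asboolP[u uZ <-] /asboolP[v vZ <-]]; apply/asboolP.
    by exists 0; rewrite ?linear0.
  by exists (a *: u + v); [exact: Zlin | rewrite linearP].
have [r rZ pr] : exists2 r : seq V, (forall v, v \in r -> v \in Z) & t = map p r.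
  have : forall w, w \in t -> exists2 v, v \in Z & p v = w.
    by move=> w wt; have := lspan_mem (A := [set` t]) wt; rewrite -tZ => /asboolP.
  elim: t {tZ} => [|w t IHt] tP; first by exists [::].
  have [v vZ <-] := tP w (mem_head _ _).
  have [w' w't|r rZ ->] := IHt; first by apply: tP; rewrite inE w't orbT.
  by exists (v :: r) => // x; rewrite inE => /orP[/eqP->|/rZ].
exists (map i s ++ r) => x; apply/idP/idP => [xZ|]; last first.
  apply: lspan_min => // a /=; rewrite mem_cat => /orP[/mapP[u us ->]|/rZ //].
  suff : u \in (fun u => i u \in Z) by [].
  by rewrite sZ; exact: lspan_mem.
have : p x \in lspan [set` t].
  by rewrite -tZ; apply/asboolP; exists x.
have -> : [set` t] = p @` [set` r].
  apply/seteqP; split=> [w|_ [v vr <-]] /=; rewrite pr; last exact: map_f.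
  by move=> /mapP[v vr ->]; exists v.
move=> /lspan_image[y yr pxy].
have yZ : y \in Z by apply: lspan_min yr.
have [u iu] : exists u, i u = x - y by apply: ip; rewrite linearB pxy subrr.
have : u \in (fun u => i u \in Z).
  by rewrite unfold_in iu; apply: PZ; apply: rpredB; exact: ZP.
rewrite sZ => us; rewrite -[x](subrK y) -iu.
apply: rpredD; last first.
  by apply: lspan_subset yr => a /= ar; rewrite mem_cat ar orbT.
have [c ->] := lspan_lincomb us; rewrite lincombE linear_sum.
apply: rpred_sum => j _; rewrite linearZ; apply: rpredZ; apply: lspan_mem => /=.
by rewrite mem_cat map_f ?mem_nth.
Qed.

Lemma noetherian_mod_surj U V (f : {linear U -> V}) :
  (forall v, exists u, f u = v) -> noetherian_mod U -> noetherian_mod V.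
Proof.
move=> fsurj Un.
apply: (noetherian_mod_ext (i := f) (p := (\0 : {linear V -> U}))) => //.
Qed.

Lemma noetherian_mod_fpow n V : noetherian_mod V -> noetherian_mod (fpow n V).
Proof.
move=> Vn; elim: n => [|n IHn].
  move=> W [W0 _]; exists [::] => v; have -> : v = 0 by apply/ffunP => -[].
  by rewrite W0 rpred0.
have [i iE] : exists i : {linear V -> fpow n.+1 V},
    forall v, i v = [ffun j => if j == ord0 then v else 0].
  apply: linear_exists => a u v; apply/ffunP => j; rewrite !ffunE.
  by case: eqP => // _; rewrite scaler0 addr0.
have [p pE] : exists p : {linear fpow n.+1 V -> fpow n V},
    forall c, p c = [ffun j => c (lift ord0 j)].
  by apply: linear_exists => a u v; apply/ffunP => j; rewrite !ffunE.
apply: (noetherian_mod_ext (i := i) (p := p)) => // c pc; exists (c ord0).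
rewrite iE; apply/ffunP => j; rewrite ffunE; case: (unliftP ord0 j) => [k ->|->].
  by have := congr1 (fun d : fpow n V => d k) pc; rewrite pE !ffunE => ->.
by rewrite eqxx.
Qed.

Lemma fingen_noetherian_mod V : noetherian R -> fingen V -> noetherian_mod V.
Proof.
move=> Rn /fingenP[n [f fV]]; apply: (noetherian_mod_surj fV).
exact: noetherian_mod_fpow.
Qed.

Lemma fingen_submod U V (i : {linear U -> V}) :
  injective i -> noetherian_mod V -> fingen U.
Proof.
move=> iinj Vn.
have [|s sE] := Vn (fun v => `[< exists u, i u = v >]).
  split=> [|a _ _ /asboolP[u <-] /asboolP[v <-]]; apply/asboolP.
    by exists 0; rewrite linear0.
  by exists (a *: u + v); rewrite linearP.
have [t tE] : exists t : seq U, s = map i t.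
  have : forall v, v \in s -> exists u, i u = v.
    by move=> v vs; have := lspan_mem (A := [set` s]) vs; rewrite -sE => /asboolP.
  elim: s {sE} => [|v s IHs] sP; first by exists [::].
  have [u <-] := sP v (mem_head _ _).
  have [w ws|t ->] := IHs; first by apply: sP; rewrite inE ws orbT.
  by exists (u :: t).
exists t => u; have : i u \in lspan [set` s] by rewrite -sE; apply/asboolP; exists u.
have -> : [set` s] = i @` [set` t].
  apply/seteqP; split=> [w|_ [v vr <-]] /=; rewrite tE; last exact: map_f.
  by move=> /mapP[v vr ->]; exists v.
by move=> /lspan_image[v vt /iinj <-].
Qed.

End Spans.

(** * Noetherian local rings *)

Section LocalRings.
Variable R : comNzRingType.
Hypothesis Rnoeth : noetherian R.
Implicit Types I J m : {pred R^o}.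

Lemma chain_bound (I : nat -> {pred R^o}) (s : seq R^o) :
    (forall k l, (k <= l)%N -> {subset I k <= I l}) ->
    (forall x, x \in s -> exists n, x \in I n) ->
  exists n, {subset s <= I n}.
Proof.
move=> Ile; elim: s => [|x s IHs] sI; first by exists 0%N.
have [y ys|n sn] := IHs; first by apply: sI; rewrite inE ys orbT.
have [k xk] := sI x (mem_head _ _).
exists (maxn k n) => y; rewrite inE => /orP[/eqP->|/sn yn].
  by apply: Ile xk; exact: leq_maxl.
by apply: Ile yn; exact: leq_maxr.
Qed.

(** Without a maximal member, choice yields a strictly increasing chain in [F]; its union is
    finitely generated, the generators appear together at one stage, and the chain would have to
    stop there. *)
Lemma ideal_max (F : {pred R^o} -> Prop) :
    (forall I, F I -> submod_closed I) -> (exists I, F I) ->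
  exists I, F I /\ forall J, F J -> {subset I <= J} -> {subset J <= I}.
Proof.
move=> Fsub [I0 FI0]; apply: contrapT => nomax.
have next (I : {I | F I}) : exists J : {I | F I},
    {subset sval I <= sval J} /\ exists2 x, x \in sval J & x \notin sval I.
  apply: contrapT => noJ; apply: nomax; exists (sval I); split; first exact: svalP I.
  move=> J FJ IJ x xJ; apply: contraT => xI; case: noJ.
  by exists (exist _ J FJ); split=> //; exists x.
pose f (K : {I | F I}) := sval (cid (next K)); pose S n := iter n f (exist _ I0 FI0).
have Sle k l : (k <= l)%N -> {subset sval (S k) <= sval (S l)}.
  move=> /subnK <-; elim: (l - k)%N => [|d IHd] x; first by rewrite add0n.
  by move=> /IHd xS; rewrite addSn /S iterS /f; case: (cid _) => J /= [+ _]; apply.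
have [|s sE] := Rnoeth (I := fun x => `[< exists n, x \in sval (S n) >]).
  split=> [|a x y /asboolP[k xk] /asboolP[l yl]]; apply/asboolP.
    by exists 0%N; case: (Fsub _ (svalP (S 0%N))).
  exists (maxn k l); have [_ lin] := Fsub _ (svalP (S (maxn k l))).
  by apply: lin; [apply: Sle xk; exact: leq_maxl | apply: Sle yl; exact: leq_maxr].
have [|n sn] := chain_bound (I := fun n => sval (S n)) (s := s) Sle.
  by move=> x xs; have := lspan_mem (A := [set` s]) xs; rewrite -sE => /asboolP.
have : exists2 x, x \in sval (S n.+1) & x \notin sval (S n).
  by rewrite /S iterS /f; case: (cid _) => J /= [].
move=> [x xS /negP[]].
have : x \in lspan [set` s] by rewrite -sE; apply/asboolP; exists n.+1.
by apply: lspan_min => //; exact: Fsub (svalP (S n)).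
Qed.

Lemma idealr_submod (m : {pred R}) : idealr_closed m -> submod_closed (m : {pred R^o}).
Proof. by case=> m0 _ mlin; split=> // a x y; exact: mlin. Qed.

Lemma local_unit (m : {pred R}) a : local_ring m -> a \notin m -> exists b, b * a = 1.
Proof.
move=> [mmax muniq] am; apply: contrapT => nb.
pose F I := [/\ submod_closed I, 1 \notin I & a \in I].
have [||I [[Isub I1 aI] Imax]] := ideal_max (F := F).
- by move=> ? [].
- exists (fun x : R^o => `[< exists r : R, x = r * a >]); split.
  + split=> [|r _ _ /asboolP[u ->] /asboolP[v ->]]; apply/asboolP.
      by exists 0; rewrite mul0r.
    by exists (r * u + v); rewrite mulrDl -mulrA.
  + by apply/asboolP => -[r e]; apply: nb; exists r.
  by apply/asboolP; exists 1; rewrite mul1r.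
have [I0 Ilin] := Isub.
have /muniq mI : maximal_ideal (I : {pred R}).
  split; first by split=> // r; exact: Ilin.
  move=> J [J0 J1 Jlin] IJ; apply: (Imax J) => //; split; [split | exact: J1 | exact: IJ].
    exact: J0.
  exact: Jlin.
by move: am; rewrite -mI aI.
Qed.

Section Ideal.
Variable m : {pred R}.
Hypothesis mlocal : local_ring m.

Lemma local_ideal : idealr_closed m. Proof. by case: mlocal => -[]. Qed.

Lemma local_ideal_submod : submod_closed (m : {pred R^o}).
Proof. exact: idealr_submod local_ideal. Qed.

Lemma local_idealM a b : b \in m -> a * b \in m.
Proof. by have [m0 lin] := local_ideal_submod; move=> bm; rewrite -[_ * _]addr0; exact: lin. Qed.

Lemma local_idealD a b : a \in m -> b \in m -> a + b \in m.
Proof. by have [m0 lin] := local_ideal_submod; move=> am bm; rewrite -[a]mul1r; exact: lin. Qed.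

Lemma local_ideal1 : 1 \notin m. Proof. by case: local_ideal. Qed.

(* Minimal generators of [V] modulo [U], which packages Nakayama's lemma. *)
Lemma minimal_generators (V : lmodType R) (U : {pred V}) : submod_closed U ->
    (exists n (f : 'I_n -> V), forall v, exists c, v - lincomb f c \in U) ->
  exists n (f : 'I_n -> V), (forall v, exists c, v - lincomb f c \in U) /\
    forall c, lincomb f c \in U -> forall i, c i \in m.
Proof.
move=> Usub gen.
have UP x : x \in U -> x \in lspan [set y | y \in U] by move=> ?; exact: lspan_mem.
have PU x : x \in lspan [set y | y \in U] -> x \in U by exact: lspan_min.
pose P n := `[< exists f : 'I_n -> V, forall v, exists c, v - lincomb f c \in U >].
have exP : exists n, P n by case: gen => n [f fP]; exists n; apply/asboolP; exists f.
case: (ex_minnP exP) => n /asboolP[f fP] nmin; exists n, f; split=> // c cU i.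
apply: contraT => /(local_unit mlocal)[b bc].
move: bc; case: n => [|n] in f fP nmin c cU i *; first by case: i.
move=> bc.
suff /nmin : P n by rewrite ltnn.
apply/asboolP; exists (f \o lift i) => v; have [d dU] := fP v.
(* As [c i] is a unit, subtracting [a *: c] cancels the [i]-th coefficient of [d] without changing
   the class modulo [U]. Generator [i] is thus redundant, against the minimality of the number of
   generators. *)
pose a : R := d i * b; pose e := d - a *: c.
have ei : e i = 0.
  by rewrite !ffunE -[_ *: _]/(a * c i) /a -mulrA bc mulr1 subrr.
exists [ffun j => e (lift i j)]; apply: PU.
have -> : lincomb (f \o lift i) [ffun j => e (lift i j)] = lincomb f d - a *: lincomb f c.
  by rewrite -linearZ -linearB -/e (lincomb_lift f i) ei scale0r add0r.
rewrite opprB addrCA addrC.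
by apply: rpredD; [exact: UP | apply: rpredZ; exact: UP].
Qed.

End Ideal.
End LocalRings.

(** * Prime avoidance and maximal regular sequences *)

Section RegularSequences.
Variable R : comNzRingType.
Hypothesis Rnoeth : noetherian R.
Variable m : {pred R}.
Hypothesis mlocal : local_ring m.

Section PrimeAvoidance.
Variable J : {pred R^o}.
Hypothesis Jsub : submod_closed J.
Implicit Types s t : R^o.

Let J0 : 0 \in J. Proof. by case: Jsub. Qed.
Let JD (x y : R^o) : x \in J -> y \in J -> x + y \in J.
Proof. by move=> xJ yJ; rewrite -[x]scale1r; apply: Jsub.2. Qed.
Let JM (a : R) (x : R^o) : x \in J -> a * x \in J.
Proof. by move=> xJ; rewrite -[_ * _]addr0; apply: (Jsub.2 a). Qed.
Let JDr (x y : R^o) : x \in J -> x + y \in J -> y \in J.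
Proof.
move=> xJ xyJ; have -> : y = (-1) * x + (x + y) by rewrite mulN1r addrA addNr add0r.
by apply: JD => //; exact: JM.
Qed.

(** The ideal quotient [(J : s)], that is, the annihilator of the class of [s] in [R / J]. The
    maximal ones, for nonzero classes, are associated primes of [R / J], and every zero divisor
    modulo [J] lies in one of them. *)
Definition colon s : {pred R^o} := fun y => y * s \in J.
Definition maximal_colon s : Prop :=
  s \notin J /\ forall t, t \notin J -> {subset colon s <= colon t} ->
                  {subset colon t <= colon s}.

Lemma colon_submod s : submod_closed (colon s).
Proof.
split=> [|a x y]; rewrite !unfold_in /colon ?mul0r // => xs ys.
by rewrite mulrDl; apply: JD => //; rewrite -mulrA; exact: JM.
Qed.

Lemma maximal_colon_ex s : s \notin J ->
  exists2 t, maximal_colon t & {subset colon s <= colon t}.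
Proof.
move=> sJ.
pose F (I : {pred R^o}) := exists t, [/\ t \notin J, {subset colon s <= colon t} & I = colon t].
have [||I [[t [tJ st ->]] tmax]] := ideal_max Rnoeth (F := F).
- by move=> I [t [_ _ ->]]; exact: colon_submod.
- by exists (colon s), s; split.
exists t => //; split=> // u uJ tu; apply: tmax => //.
by exists u; split=> // x /st/tu.
Qed.

(** If [b * s] is not in [J], its annihilator contains that of [s], hence equals it by maximality,
    and [a] lies in it. *)
Lemma maximal_colon_prime s a b : maximal_colon s ->
  a * b \in colon s -> a \in colon s \/ b \in colon s.
Proof.
move=> [sJ smax] abs; case: (boolP (b \in colon s)) => [|bs]; [by right | left].
apply: (smax (b * s)) => // [x|].
  by rewrite !unfold_in /colon mulrCA; exact: JM.
by rewrite unfold_in /colon mulrA.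
Qed.

(** Stands in for the finiteness of the set of associated primes: finitely many elements with
    maximal annihilator span the same ideal as all of them, and what multiplies these into [J]
    multiplies the whole span into [J]. *)
Lemma maximal_colon_finite : exists2 l : seq R^o,
  (forall s, s \in l -> maximal_colon s) &
  forall y, (forall s, s \in l -> y \in colon s) ->
    forall s, maximal_colon s -> y \in colon s.
Proof.
have [|t tE] := Rnoeth (I := lspan [set s | maximal_colon s]).
  exact: lspan_submod.
have [|l lmax tl] := lspan_seq_fin (A := [set s | maximal_colon s]) (s := t).
  by move=> v vt; rewrite tE; exact: lspan_mem.
exists l => // y yl s smax.
have : s \in lspan [set` t] by rewrite -tE; exact: lspan_mem.
have ysub : submod_closed (fun s : R^o => y * s \in J).
  split=> [|a u v]; rewrite !unfold_in ?mulr0 // => yu yv.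
  by rewrite mulrDr; apply: JD => //; rewrite mulrCA; exact: JM.
apply: (lspan_min (W := fun s : R^o => y * s \in J)) => // a /tl.
by apply: lspan_min => // b /yl.
Qed.

(** Choose in each [colon t] an element outside [colon s]; by primality of [colon s] their product
    stays outside. *)
Lemma maximal_colon_separate (l : seq R^o) s : maximal_colon s ->
    (forall t, t \in l -> ~ {subset colon t <= colon s}) ->
  exists2 z, z \notin colon s & forall t, t \in l -> z \in colon t.
Proof.
move=> smax; elim: l => [|t l IHl] lP.
  by exists 1 => //; rewrite unfold_in /colon mul1r; case: smax.
have [u ul|z zs zl] := IHl; first by apply: lP; rewrite inE ul orbT.
have [x xt xs] : exists2 x, x \in colon t & x \notin colon s.
  apply: contrapT => nx; apply: (lP t); first exact: mem_head.
  by move=> x xt; apply: contraT => xs; case: nx; exists x.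
exists (x * z).
  by apply/negP => /(maximal_colon_prime smax)[xs'|zs']; [rewrite xs' in xs | rewrite zs' in zs].
move=> u; rewrite inE => /orP[/eqP->|/zl zu].
  by rewrite unfold_in /colon mulrAC mulrC; exact: JM.
by rewrite unfold_in /colon -mulrA; exact: JM.
Qed.

Lemma prime_avoidance : (forall s, s \notin J -> exists2 y, y \in m & y * s \notin J) ->
  exists2 y, y \in m & forall s, y * s \in J -> s \in J.
Proof.
move=> noann.
have incomp y s (l : seq R^o) : maximal_colon s -> y \in colon s ->
    (forall t, t \in l -> maximal_colon t) ->
    (forall t, t \in l -> y \notin colon t) ->
    forall t, t \in l -> ~ {subset colon t <= colon s}.
  move=> [sJ _] ys lmax yl t tl ts; have [_ tmax] := lmax t tl.
  by move: (yl t tl); rewrite (tmax s).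
have [l lmax lP] := maximal_colon_finite.
have [y ym yl] : exists2 y, y \in m & forall s, s \in l -> y \notin colon s.
  elim: l lmax {lP} => [|s l IHl] lmax.
    by exists 0 => //; case: (local_ideal_submod mlocal).
  have [t tl|y ym yl] := IHl; first by apply: lmax; rewrite inE tl orbT.
  case: (boolP (y \in colon s)) => ys; last first.
    by exists y => // t; rewrite inE => /orP[/eqP->|/yl].
  have smax := lmax s (mem_head _ _).
  have [|z zs zl] := maximal_colon_separate (l := l) smax.
    apply: (incomp y) => // t tl; by apply: lmax; rewrite inE tl orbT.
  have [w wm ws] := noann s (smax.1).
  (* The summand [z * w] moves [y] out of the prime [colon s], which contains neither factor, and
     does not change [y] modulo the [colon t] already avoided, which contain [z]. *)
  exists (y + z * w).
    by apply: (local_idealD mlocal) => //; exact: (local_idealM mlocal).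
  move=> t; rewrite inE => /orP[/eqP->|tl]; apply/negP; rewrite unfold_in /colon mulrDl.
    move=> /(JDr ys) /(maximal_colon_prime smax)[zs'|ws']; first by rewrite zs' in zs.
    by move: ws; rewrite -[_ * s \in J]/(w \in colon s) ws'.
  move=> yzt; have /negP := yl t tl; apply; rewrite unfold_in /colon.
  apply: (JDr (x := z * w * t)); last by rewrite addrC.
  by rewrite mulrAC mulrC; apply: JM; exact: zl.
exists y => // s ysJ; apply: contraT => sJ.
(* A zero divisor [y] would lie in a maximal [colon t]. As [y] avoids the annihilators of the
   members of [l], none of these is contained in [colon t], so some [z] outside [colon t] lies in
   all of them, contrary to the choice of [l]. *)
have [t tmax st] := maximal_colon_ex sJ.
have yt : y \in colon t by apply: st.
have [|z zt zl] := maximal_colon_separate (l := l) tmax; first exact: (incomp y).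
by move: zt; rewrite (lP z zl t tmax).
Qed.

End PrimeAvoidance.

Definition regular_on (s : seq R^o) : Prop :=
  forall i, (i < size s)%N -> forall x : R^o,
    s`_i * x \in lspan [set` take i s] -> x \in lspan [set` take i s].

(* The sequence is a maximal regular sequence, so that [u] spans a copy of the
   residue field in [R / (s)]. *)
Lemma maximal_regular_seq : exists (s : seq R^o) (u : R^o),
  [/\ regular_on s, u \notin lspan [set` s] & forall y, y \in m -> y * u \in lspan [set` s]].
Proof.
(* Maximality is that of the generated ideal, not of the length, so the ascending chain condition
   applies directly. *)
pose F (I : {pred R^o}) := exists s : seq R^o,
  [/\ regular_on s, {subset s <= m} & I = lspan [set` s]].
have Fsub I : F I -> submod_closed I by move=> [s [_ _ ->]]; exact: lspan_submod.
have msub := local_ideal_submod mlocal.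
have [|I [[s [sreg sm ->]] smax]] := ideal_max Rnoeth Fsub.
  by exists (lspan [set` [::]]), [::]; split.
exists s; apply: contrapT => nou.
have [|y ym yreg] := prime_avoidance (lspan_submod [set` s]).
  move=> u us; apply: contrapT => noy; apply: nou; exists u; split=> // y ym.
  by apply: contraT => yu; case: noy; exists y.
have : y \in lspan [set` s].
  apply: (smax (lspan [set` rcons s y])).
  - exists (rcons s y); split=> // [i|x].
      rewrite size_rcons ltnS leq_eqVlt => /orP[/eqP->|si] x; rewrite nth_rcons.
        by rewrite ltnn eqxx -cats1 take_size_cat //; exact: yreg.
      by rewrite si -cats1 takel_cat ?(ltnW si) //; exact: sreg.
    by rewrite mem_rcons inE => /orP[/eqP->|/sm].
  - by apply: lspan_subset => x /= xs; rewrite mem_rcons inE xs orbT.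
  by apply: lspan_mem; rewrite /= mem_rcons mem_head.
(* Since [y * 1] is in the ideal and [y] is regular modulo it, [1] is in the ideal, which lies in
   [m]. *)
rewrite -[y]mulr1 => /yreg s1.
have /negP[] := local_ideal1 mlocal.
have lsm : {subset lspan [set` s] <= (m : {pred R^o})} by exact: lspan_min.
exact: lsm.
Qed.

End RegularSequences.

(** * Minimal resolutions *)

Section MinimalResolution.
Variable R : comNzRingType.
Hypothesis Rnoeth : noetherian R.
Variable m : {pred R}.
Hypothesis mlocal : local_ring m.
Implicit Types L M V Y : lmodType R.

Lemma minimal_cover M : fingen M ->
  exists n (f : 'I_n -> M), (forall v, exists c, lincomb f c = v) /\
    forall c, lincomb f c = 0 -> forall i, c i \in m.
Proof.
move=> /fingenP[n [f fP]].
have [||k [g [gP gm]]] := minimal_generators Rnoeth mlocal (U := fun v : M => v == 0).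
- split=> [|a u v]; rewrite !unfold_in // => /eqP-> /eqP->.
  by rewrite scaler0 addr0.
- exists n, f => v; have [c <-] := fP v; exists c; rewrite unfold_in subrr.
  exact: eqxx.
exists k, g; split=> [v|c /eqP]; last exact: gm.
by have [c] := gP v; rewrite unfold_in subr_eq0 => /eqP; exists c.
Qed.

(** Total in [M], with the empty family as default, so that syzygies can be iterated without
    carrying a proof of finite generation. *)
Definition mingens M : {n & 'I_n -> M} :=
  if pselect (fingen M) is left Mfg then
    let n := cid (minimal_cover Mfg) in Tagged (fun n => 'I_n -> M) (sval (cid (svalP n)))
  else Tagged (fun n => 'I_n -> M) (fun _ : 'I_0 => 0).

Definition mincover M : {linear fpow (tag (mingens M)) R^o -> M} :=
  lincomb (tagged (mingens M)).
Definition minsyz M : lmodType R := kermod (mincover M).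

Lemma mincoverP M : fingen M -> (forall v, exists c, mincover M c = v) /\
  forall c, mincover M c = 0 -> forall i, c i \in m.
Proof.
rewrite /mincover /mingens; case: pselect => // Mfg _ /=.
exact: svalP (cid (svalP (cid (minimal_cover Mfg)))).
Qed.

Lemma minsyz_short_exact M : fingen M -> short_exact (kerval (mincover M)) (mincover M).
Proof. by move=> /mincoverP[fsurj _]; exact: ker_short_exact. Qed.

Lemma fingen_minsyz M : fingen (minsyz M).
Proof.
apply: (fingen_submod (@kerval_inj _ _ _ (mincover M))).
exact: noetherian_mod_fpow.
Qed.

Definition syz n M := iter n minsyz M.

Lemma fingen_syz n M : fingen M -> fingen (syz n M).
Proof. by case: n => // n _; exact: fingen_minsyz. Qed.

Lemma syz_short_exact n M : fingen M ->
  exists (i : {linear syz n.+1 M -> fpow (tag (mingens (syz n M))) R^o})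
    (p : {linear fpow (tag (mingens (syz n M))) R^o -> syz n M}), short_exact i p.
Proof.
move=> Mfg; exists (kerval (mincover (syz n M))), (mincover (syz n M)).
exact/minsyz_short_exact/fingen_syz.
Qed.

Lemma syzD k n M : syz k (syz n M) = syz (k + n) M.
Proof. by rewrite /syz iterD. Qed.

Lemma ext_zero_syz n M Y : fingen M -> ext_zero n M Y <-> ext1_zero (syz n M) Y.
Proof.
elim: n M => [|n IHn] M Mfg //.
rewrite (ext_zero_syzygy _ _ (minsyz_short_exact Mfg)); last exact: fpow_projective.
by rewrite IHn; [rewrite /syz iterSr | exact: fingen_minsyz].
Qed.

Lemma ext_zero_syzD n k M Y : fingen M ->
  ext_zero n (syz k M) Y <-> ext1_zero (syz (n + k) M) Y.
Proof. by move=> Mfg; rewrite ext_zero_syz ?syzD //; exact: fingen_syz. Qed.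

Lemma ext1_zero_fpow n L : ext1_zero L R^o -> ext1_zero L (fpow n R^o).
Proof.
move=> ext A B i p ip h.
have hP j : exists g : {linear B -> R^o}, forall a, g (i a) = h a j.
  have [e eE] : exists e : {linear fpow n R^o -> R^o}, forall c, e c = c j.
    by apply: linear_exists => a u v; rewrite !ffunE.
  by have [g gP] := ext _ _ _ _ ip (e \o h); exists g => a; rewrite gP /= eE.
have [g gP] := choice hP.
have [g' g'E] : exists g' : {linear B -> fpow n R^o}, forall b, g' b = [ffun j => g j b].
  by apply: linear_exists => a u v; apply/ffunP => j; rewrite !ffunE linearP.
by exists g' => a; apply/ffunP => j; rewrite g'E ffunE gP.
Qed.

Section RegularSequence.
Variable s : seq R^o.
Hypothesis sreg : regular_on s.

Definition seq_mul k V (v : V) : Prop :=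
  exists c : nat -> V, v = \sum_(i < k) (s`_i : R) *: c i.

Lemma lspan_take k (a : R^o) : (k <= size s)%N ->
  a \in lspan [set` take k s] <-> seq_mul k a.
Proof.
move=> ks; split=> [|[c ->]]; last first.
  apply: rpred_sum => i _; rewrite -[_ *: _]/(_ * _) mulrC; apply: (rpredZ (c i)).
  apply: lspan_mem; rewrite /= -(nth_take 0 (ltn_ord i)) mem_nth // size_take_min.
  by rewrite leq_min ltn_ord (leq_trans (ltn_ord i)).
move: a; apply: lspan_ind => [|a _ _ [c ->] [d ->]|_ /(nthP 0)[j + <-]].
- by exists (fun=> 0); rewrite big1 // => i _; rewrite scaler0.
- exists (fun i => a *: c i + d i); rewrite scaler_sumr -big_split /=.
  by apply: eq_bigr => i _; rewrite scalerDr !scalerA mulrC.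
rewrite size_take_min leq_min => /andP[jk _].
exists (fun i => (i == j)%:R); rewrite (bigD1 (Ordinal jk)) //= eqxx big1 ?addr0.
  by rewrite nth_take //; exact/esym/mulr1.
move=> i ij; rewrite (_ : (i == j :> nat) = false) ?scaler0 //.
by apply/negbTE.
Qed.

Lemma seq_mul_fpow k n (v : fpow n R^o) : (k <= size s)%N ->
  seq_mul k v <-> forall j, v j \in lspan [set` take k s].
Proof.
move=> ks; split=> [[c ->] j|vP].
  apply/(lspan_take _ ks); exists (fun i => c i j); rewrite sum_ffunE.
  by apply: eq_bigr => i _; rewrite ffunE.
have /choice[c cP] j : exists c : nat -> R^o, v j = \sum_(i < k) (s`_i : R) *: c i.
  exact/(lspan_take _ ks).
exists (fun i => [ffun j => c j i]); apply/ffunP => j; rewrite cP sum_ffunE.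
by apply: eq_bigr => i _; rewrite !ffunE.
Qed.

(* That is, [Tor_1 (syz n M) (R / (s_0, ..., s_(k-1))) = 0] for [k <= n]. *)
Lemma syz_seq_mul M k n (a : syz n.+1 M) : fingen M -> (k <= size s)%N -> (k <= n)%N ->
  seq_mul k (kerval (mincover (syz n M)) a) -> seq_mul k a.
Proof.
move=> Mfg; elim: k n a => [|k IHk] n a ks kn [f].
  rewrite big_ord0 => a0; exists (fun=> 0); rewrite big_ord0.
  by apply: (kerval_inj (f := mincover (syz n M))); rewrite a0 linear0.
case: n kn a f => [|n] // kn a f.
set p := mincover (syz n.+1 M); set i := kerval p => aE.
set q := mincover (syz n M); pose j := kerval q.
have [psurj _] := mincoverP (fingen_syz n.+1 Mfg).
pose b := p (f k).
(* Applying [p] to the expansion of [i a] gives a relation which puts [s_k b] in the span of the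
   earlier multiples. Regularity then cancels [s_k] inside the free module, and the induction
   hypothesis brings the membership of [j b] back to the syzygy. *)
have : seq_mul k (s`_k *: j b).
  exists (fun l => - j (p (f l))).
  have : j (p (i a)) = 0 by rewrite kervalP linear0.
  rewrite aE big_ord_recr /= !linearD !linear_sum /= addrC => /eqP; rewrite addr_eq0.
  rewrite !linearZ => /eqP ->; rewrite -sumrN; apply: eq_bigr => l _.
  by rewrite !linearZ /= scalerN.
move=> /(seq_mul_fpow _ (ltnW ks)) sb.
have /IHk[||c bE] : seq_mul k (j b).
- apply/(seq_mul_fpow _ (ltnW ks)) => l; apply: sreg => //.
  by have := sb l; rewrite ffunE.
- exact: ltnW.
- by [].
have /choice[f' f'E] l : exists x, p x = c l by exact: psurj.
(* Correcting [f k] by multiples of the earlier [s_l] moves it into the syzygy. This gives the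
   coefficient [ak] of [s_k]; the remainder involves earlier terms only and falls under the
   induction hypothesis. *)
pose x := f k - \sum_(l < k) (s`_l : R) *: f' l.
have [ak akE] : exists ak, i ak = x.
  apply: kerval_ex; rewrite linearB linear_sum -/b bE; apply/eqP; rewrite subr_eq0.
  by apply/eqP/eq_bigr => l _; rewrite linearZ /= f'E.
have : seq_mul k (i (a - s`_k *: ak)).
  exists (fun l => f l + s`_k *: f' l).
  rewrite linearB linearZ akE aE big_ord_recr /= /x scalerBr.
  rewrite opprB addrA addrAC addrK scaler_sumr -big_split /=.
  by apply: eq_bigr => l _; rewrite scalerDr !scalerA mulrC.
move=> /IHk[||d dE]; [exact: ltnW | exact: ltnW |].
exists (fun l => if l == k then ak else d l).
rewrite big_ord_recr /= eqxx -[LHS](subrK (s`_k *: ak)); congr (_ + _).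
rewrite dE; apply: eq_bigr => l _; rewrite (_ : (l == k :> nat) = false) //.
by apply/negbTE; rewrite neq_ltn ltn_ord.
Qed.

End RegularSequence.

(* Auslander-Buchsbaum: [u] carries [A = syz n.+1 M], which lies in [m F], into
   [s F] and hence into [s A]; applying a coordinate of a splitting [A -> R^r]
   with unit value to this contradicts [u \notin (s)] unless [A = 0]. *)
Lemma syz_projective_descent (s : seq R^o) (u : R^o) M n :
    regular_on s -> u \notin lspan [set` s] ->
    (forall y, y \in m -> y * u \in lspan [set` s]) ->
    fingen M -> (size s <= n)%N ->
  projective (syz n.+1 M) -> projective (syz n M).
Proof.
move=> sreg us um Mfg sn Aproj; set A := syz n.+1 M in Aproj.
have [psurj pm] := mincoverP (fingen_syz n Mfg); set p := mincover _ in psurj pm.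
pose i := kerval p.
have [r [f [fP fm]]] := minimal_cover (fingen_syz n.+1 Mfg).
(* With no generators [A = 0], so the free cover [p] of [syz n M] is an isomorphism. *)
suff A0 : r = 0%N.
  have A00 (a : A) : a = 0.
    by have [c <-] := fP a; rewrite lincombE; case: r A0 f {fP fm} c => // _ f c; rewrite big_ord0.
  have [t tE] := linear_factor_surj (f := idfun) psurj
    (fun c pc => let: ex_intro k kE := kerval_ex pc in
       etrans (esym kE) (etrans (congr1 (kerval p) (A00 k)) (linear0 _))).
  apply: (projective_retract (s := t) (r := p)); last exact: fpow_projective.
  by move=> x; have [c <-] := psurj x; rewrite tE.
case: r f fP fm => // r f fP fm; exfalso.
have [t tP] := Aproj _ _ (lincomb f) idfun fP.
(* [lincomb f] kills the difference of [t (f ord0)] and the first basis vector, so minimality of the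
   generators puts its coordinates in [m]; the coordinate [t (f ord0) ord0] is therefore a unit. *)
have tm : t (f ord0) ord0 - 1 \in m.
  have := fm (t (f ord0) - fpow_delta R ord0); rewrite linearB tP lincomb_delta subrr.
  by move=> /(_ erefl ord0); rewrite !ffunE eqxx.
have [|b bE] := local_unit Rnoeth mlocal (a := t (f ord0) ord0).
  apply/negP => tm'; have /negP := local_ideal1 mlocal; apply.
  have -> : 1 = (-1) * (t (f ord0) ord0 - 1) + t (f ord0) ord0.
    by rewrite mulN1r opprB subrK.
  by apply: (local_idealD mlocal) => //; exact: (local_idealM mlocal).
have : seq_mul s (size s) (i (u *: f ord0)).
  apply/(seq_mul_fpow _ (leqnn _)) => j; rewrite take_size linearZ ffunE.
  rewrite -[_ *: _]/(u * _) mulrC; apply: um; apply: pm; exact: kervalP.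
move=> /(syz_seq_mul sreg Mfg (leqnn _) sn)[c cE].
have : seq_mul s (size s) (t (u *: f ord0)).
  exists (fun l => t (c l)); rewrite cE linear_sum.
  by apply: eq_bigr => l _; rewrite linearZ.
move=> /(seq_mul_fpow _ (leqnn _)) /(_ ord0); rewrite take_size linearZ ffunE.
move=> uts; have /negP := us; apply.
have -> : u = b *: (u *: t (f ord0) ord0 : R^o).
  by rewrite -[RHS]/(b * (u * _)) mulrCA bE mulr1.
exact: rpredZ.
Qed.

End MinimalResolution.

Section ExtensionDegree.
Variable R : comNzRingType.
Implicit Types L M Y : lmodType R.

Lemma ereal_nat_bound (x : \bar Rdefinitions.R) :
  (x < +oo)%E -> exists n : nat, (x <= (n%:R)%:E)%E.
Proof.
case: x => [r _||_] //; last by exists 0%N; rewrite leNye.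
exists (Num.bound `|r|); rewrite lee_fin; apply: le_trans (ler_norm r) _.
exact/ltW/archi_boundP/normr_ge0.
Qed.

Lemma ext_deg_le M n : (ext_deg M <= (n%:R)%:E)%E <->
  forall i, (n < i)%N -> Ext_eq0 i M M.
Proof.
split=> [Mn i ni|Mn].
  apply: contrapT => nE; suff : (i%:R : Rdefinitions.R) <= n%:R by rewrite ler_nat leqNgt ni.
  by rewrite -lee_fin; apply: le_trans Mn; apply: ereal_sup_ubound; exists i.
apply: ge_ereal_sup => _ [i /= nE <-]; rewrite lee_fin ler_nat leqNgt.
by apply/negP => /Mn.
Qed.

Lemma ext_deg_fin M : (ext_deg M < +oo)%E <->
  exists k, forall i, (k <= i)%N -> Ext_eq0 i M M.
Proof.
split=> [/ereal_nat_bound[n /ext_deg_le nM]|[k kM]]; first by exists n.+1.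
apply: le_lt_trans (ltry k%:R); apply/ext_deg_le => i ki; apply: kM; exact: ltnW.
Qed.

Lemma ext_deg_dsum_fin M : (ext_deg (dsum M R^o) < +oo)%E <->
  exists k, forall i, (k <= i)%N -> ext_zero i M M /\ ext_zero i M R^o.
Proof.
have E i : Ext_eq0 i.+1 (dsum M R^o) (dsum M R^o) <-> ext_zero i M M /\ ext_zero i M R^o.
  rewrite Ext_eq0S ext_zero_dsum ext_zero_dsumr; split=> [[]//|h]; split=> //.
  have Rproj : projective (R^o : lmodType R) by exact: regular_projective.
  exact: projective_ext_zero.
rewrite ext_deg_fin; split=> -[k kP].
  by exists k => i ki; apply/E/kP; exact: leqW.
by exists k.+1 => -[|i] // ki; apply/E/kP.
Qed.

End ExtensionDegree.

(** * Dimension shifting along syzygies, and (1) => (2) *)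

Section MinimalResolutionExt.
Variable R : comNzRingType.
Hypothesis Rnoeth : noetherian R.
Variable m : {pred R}.
Hypothesis mlocal : local_ring m.
Implicit Types L M Y : lmodType R.
Local Notation syz := (syz Rnoeth mlocal).

(** [Omega^k M] has a free cover, so the connecting map [Ext^(n+1)(M, Omega^k M) -> Ext^(n+2)(M,
    Omega^(k+1) M)] is injective once [Ext^(n+1)(M, R) = 0]. *)
Lemma ext1_zero_syz_down n k M : fingen M ->
    ext1_zero (syz n M) R^o -> ext1_zero (syz n.+1 M) (syz k.+1 M) ->
  ext1_zero (syz n M) (syz k M).
Proof.
move=> Mfg extR ext.
have [i [p ip]] := syz_short_exact Rnoeth mlocal n Mfg.
have [j [q jq]] := syz_short_exact Rnoeth mlocal k Mfg.
apply: (ext1_zero_quot ip _ jq) => //; first exact: fpow_projective.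
exact: ext1_zero_fpow.
Qed.

(** Surjectivity of the same connecting map, controlled by [Ext^(n+2)(M, R)]. *)
Lemma ext1_zero_syz_up n k M : fingen M ->
    ext1_zero (syz n.+1 M) R^o -> ext1_zero (syz n M) (syz k M) ->
  ext1_zero (syz n.+1 M) (syz k.+1 M).
Proof.
move=> Mfg extR ext.
have [i [p ip]] := syz_short_exact Rnoeth mlocal n Mfg.
have [i2 [p2 ip2]] := syz_short_exact Rnoeth mlocal n.+1 Mfg.
have [j [q jq]] := syz_short_exact Rnoeth mlocal k Mfg.
apply: (ext1_zero_sub ip _ ip2 _ jq) => //; try exact: fpow_projective.
exact: ext1_zero_fpow.
Qed.

Lemma ext1_zero_syz_syz M k : fingen M ->
    (forall n, (k <= n)%N -> ext1_zero (syz n M) R^o) ->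
    (forall n, (k <= n)%N -> ext1_zero (syz n M) M) ->
  forall l n, (k + l <= n)%N -> ext1_zero (syz n M) (syz l M).
Proof.
move=> Mfg extR extM; elim=> [|l IHl] n kn; first by apply: extM; rewrite -[k]addn0.
case: n kn => [|n]; rewrite addnS // ltnS => kn.
apply: ext1_zero_syz_up => //; last exact: IHl.
by apply: extR; apply: leqW; exact: leq_trans (leq_addr _ _) kn.
Qed.

Lemma syz_projective_up M n k : fingen M -> (n <= k)%N ->
  projective (syz n M) -> projective (syz k M).
Proof.
move=> Mfg /subnK <-; elim: (k - n)%N => [|d IHd] // proj.
have [i [p ip]] := syz_short_exact Rnoeth mlocal (d + n) Mfg.
by apply: (kernel_projective ip); [exact: fpow_projective | exact: IHd].
Qed.

Lemma SAC_rfed : SAC R -> (rfed R < +oo)%E.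
Proof.
move=> sac.
have [s [u [sreg us um]]] := maximal_regular_seq Rnoeth mlocal.
apply: le_lt_trans (ltry (size s)%:R); apply: ge_ereal_sup => _ [M [Mfg -> Mfin]].
have [k kP] := (ext_deg_dsum_fin M).1 Mfin.
have extR n : (k <= n)%N -> ext1_zero (syz n M) R^o.
  by move=> kn; apply/(ext_zero_syz Rnoeth mlocal) => //; have [] := kP n kn.
have extM n : (k <= n)%N -> ext1_zero (syz n M) M.
  by move=> kn; apply/(ext_zero_syz Rnoeth mlocal) => //; have [] := kP n kn.
have extS := ext1_zero_syz_syz Mfg extR extM.
have Nproj : projective (syz k M).
  have : Ext_eq0 1 (dsum (syz k M) (syz k.+1 M)) (dsum (syz k M) (syz k.+1 M)).
    apply: sac => //.
    - by apply: fingen_dsum; exact: fingen_syz.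
    - move=> [|i] // _; apply/Ext_eq0S/ext_zero_dsum.
      split; apply/ext_zero_syzD => //; apply: extR; first exact: leq_addl.
      by rewrite addnS; apply: leqW; exact: leq_addl.
    (* The last of the four summands to vanish is [Ext(Omega^k M, Omega^(k+1) M)]: there [extS] asks
       for [k + k.+1 <= i + k], that is [k < i], and [ext_zero i] is [Ext^(i+1)]. *)
    exists k.+2 => -[|i] // ki; apply/Ext_eq0S/ext_zero_dsum.
    have kki : (k + k.+1 <= i + k)%N by rewrite addnC leq_add2r.
    split; apply/ext_zero_dsumr; split; apply/ext_zero_syzD => //; apply: extS.
    - by apply: leq_trans kki; rewrite leq_add2l.
    - exact: kki.
    - by rewrite addnS; apply: leqW; apply: leq_trans kki; rewrite leq_add2l.
    - by apply: leq_trans kki _; rewrite leq_add2l.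
  move=> /Ext_eq0S/ext_zero_dsum[/ext_zero_dsumr[_ /= ext] _].
  have [i [p ip]] := syz_short_exact Rnoeth mlocal k Mfg.
  have [q qP] := ext1_zero_lift ip ext idfun.
  by apply: (projective_retract (s := q) (r := p)) => //; exact: fpow_projective.
have sproj : projective (syz (size s) M).
  (* Projectivity passes to later syzygies because kernels of surjections between projectives split
     off; to earlier ones, down to index [size s], by Auslander-Buchsbaum. *)
  case: (leqP k (size s)) => [ks|/ltnW/subnK ks]; first exact: syz_projective_up Nproj.
  move: Nproj; rewrite -ks addnC; elim: (k - size s)%N => [|d IHd]; first by rewrite addn0.
  rewrite addnS => /(syz_projective_descent sreg us um Mfg) proj.
  by apply: IHd; apply: proj; exact: leq_addr.
apply/ext_deg_le => -[|i] // si; apply/Ext_eq0S/ext_zero_dsum; split; last first.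
  exact/projective_ext_zero/regular_projective.
apply/(ext_zero_syz Rnoeth mlocal) => //; apply: projective_ext1_zero.
exact: syz_projective_up sproj.
Qed.

End MinimalResolutionExt.

(** * Reduction modulo a regular element *)

Section Quotients.
Variable R : comNzRingType.
Implicit Types V U : lmodType R.

Lemma quomod_pi V (W : submodClosed V) : exists p : {linear V -> quomod W},
  [/\ p =1 \pi_(quomod W)%qT, forall c, exists v, p v = c
    & forall v, p v = 0 <-> v \in W].
Proof.
have [a u v|p pE] := @linear_exists R V (quomod W) (\pi_(quomod W)%qT).
  by rewrite raddfD; congr (_ + _); exact/esym/pi_scale.
exists p; split=> // [c|v]; first by exists (repr c); rewrite pE reprK.
by rewrite pE -quomod_eq0; split=> [->|/eqP].
Qed.

Lemma quotient_exists V (W : {pred V}) : submod_closed W ->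
  exists (Q : lmodType R) (p : {linear V -> Q}),
    (forall c, exists v, p v = c) /\ (forall v, p v = 0 <-> v \in W).
Proof.
move=> Wsub; have [p [_ psurj pW]] := quomod_pi (lspan [set v | v \in W]).
exists (quomod (lspan [set v | v \in W])), p; split=> // v.
rewrite pW; split=> [|Wv]; last exact: lspan_mem.
exact: lspan_min.
Qed.

Lemma regular_quotient V (x : R) : (forall v : V, x *: v = 0 -> v = 0) ->
  exists (Q : lmodType R) (j : {linear V -> V}) (q : {linear V -> Q}),
    [/\ short_exact j q, forall v, j v = x *: v & forall c : Q, x *: c = 0].
Proof.
move=> xreg; have [j jE] : exists j : {linear V -> V}, forall v, j v = x *: v.
  by apply: linear_exists => a u v; rewrite scalerDr !scalerA mulrC.
have [|Q [q [qsurj qW]]] := quotient_exists (W := fun v => `[< exists u, j u = v >]).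
  split=> [|a _ _ /asboolP[u <-] /asboolP[v <-]]; apply/asboolP.
    by exists 0; rewrite linear0.
  by exists (a *: u + v); rewrite linearP.
exists Q, j, q; split=> // [|c].
  split=> // [u v|v]; last by rewrite qW; split=> /asboolP.
  by rewrite !jE => /eqP; rewrite -subr_eq0 -scalerBr => /eqP/xreg/eqP; rewrite subr_eq0 => /eqP.
have [v <-] := qsurj c; rewrite -linearZ -jE; apply/qW.
by apply/asboolP; exists v.
Qed.

End Quotients.

(** * Nakayama's lemma for [Ext] *)

Section Nakayama.
Variable R : comNzRingType.
Hypothesis Rnoeth : noetherian R.
Variable m : {pred R}.
Hypothesis mlocal : local_ring m.

(** Take generators of [T] minimal modulo [U]. If there is a first one, it is [x] times a
    combination of all of them, up to [U]; minimality then puts [1 - x * c ord0] in [m], and so [1]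
    as well. *)
Lemma nakayama (V : lmodType R) (T U : {pred V}) (x : R) :
    noetherian_mod V -> submod_closed T -> submod_closed U -> x \in m ->
    (forall t, t \in T -> exists2 t', t' \in T & t - x *: t' \in U) ->
  {subset T <= U}.
Proof.
move=> Vn Tsub Usub xm TU.
have [Q [q [qsurj qT]]] := quotient_exists Tsub.
pose i := kerval q.
have iT k : i k \in T by apply/qT; exact: kervalP.
have ex v : v \in T -> exists k, i k = v by move=> /qT; exact: kerval_ex.
have U'sub : submod_closed (fun k => i k \in U).
  by split=> [|a u v]; rewrite !unfold_in ?linear0 ?linearP; [exact: Usub.1 | exact: Usub.2].
have /fingenP[n0 [f0 f0P]] := fingen_submod (@kerval_inj _ _ _ q) Vn.
have [|n [f [fU fm]]] := minimal_generators Rnoeth mlocal U'sub.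
  exists n0, f0 => v; have [c <-] := f0P v; exists c.
  by rewrite subrr unfold_in linear0; exact: Usub.1.
case: n => [|n] in f fU fm *.
  move=> v /ex[k <-]; have [c] := fU k.
  by rewrite lincombE big_ord0 subr0.
have [t /ex[k <-] ft] := TU _ (iT (f ord0)).
have [c kc] := fU k.
pose e : fpow n.+1 R^o := fpow_delta R ord0 - x *: c.
have /fm/(_ ord0) : i (lincomb f e) \in U.
  rewrite linearB lincomb_delta linearZ.
  have -> : f ord0 - x *: lincomb f c = 1 *: (f ord0 - x *: k) + x *: (k - lincomb f c).
    by rewrite scale1r scalerBr addrA subrK.
  rewrite linearD linearZ [i (x *: _)]linearZ /=.
  apply: Usub.2; first by rewrite linearB linearZ.
  by have := Usub.2 x _ _ kc Usub.1; rewrite addr0.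
rewrite !ffunE eqxx -[x *: _]/(x * c ord0) => em.
have /negP[] := local_ideal1 mlocal.
have -> : 1 = (1 - x * c ord0) + c ord0 * x by rewrite mulrC subrK.
by apply: (local_idealD mlocal) => //; exact: (local_idealM mlocal).
Qed.

(** [Ext^1(B, Y)] is the module [T] of maps [K -> Y] modulo the submodule [U] of those that extend
    to [G]. Vanishing for [Q = Y / x Y] makes every map in [T] extendable up to [x T]. *)
Lemma ext1_zero_nakayama (K G B Y Q : lmodType R) (x : R)
    (i : {linear K -> G}) (p : {linear G -> B})
    (j : {linear Y -> Y}) (q : {linear Y -> Q}) :
    short_exact i p -> projective G -> fingen K ->
    short_exact j q -> (forall y, j y = x *: y) -> fingen Y -> x \in m ->
  ext1_zero B Q -> ext1_zero B Y.
Proof.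
move=> ip Gproj /fingenP[r [f fP]] jq jE Yfg xm ext.
have [jinj qsurj jqP] := jq.
(* Recording maps by their values on generators of [K] turns [T] and [U] into submodules of the
   Noetherian module [Y^r]. *)
pose ev (h : {linear K -> Y}) : fpow r Y := [ffun l => h (f l)].
pose T : {pred fpow r Y} := fun w => `[< exists h, ev h = w >].
pose U : {pred fpow r Y} := fun w => `[< exists g : {linear G -> Y}, ev (g \o i) = w >].
have lin (A : lmodType R) (g h : {linear A -> Y}) (a : R) :
    exists k : {linear A -> Y}, forall b, k b = a *: g b + h b.
  apply: linear_exists => b u v; rewrite [g _]linearP [h _]linearP.
  by rewrite !scalerDr !scalerA [b * a]mulrC addrACA.
have ev_eq h h' : ev h = ev h' -> h =1 h'.
  move=> e k; have [c <-] := fP k; rewrite lincombE !linear_sum.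
  apply: eq_bigr => l _; rewrite !linearZ; congr (_ *: _).
  by have := congr1 (fun w : fpow r Y => w l) e; rewrite !ffunE.
have Tsub : submod_closed T.
  split=> [|a _ _ /asboolP[h <-] /asboolP[h' <-]]; apply/asboolP.
    by exists (\0 : {linear K -> Y}); apply/ffunP => l; rewrite !ffunE.
  by have [k kE] := lin _ h h' a; exists k; apply/ffunP => l; rewrite !ffunE kE.
have Usub : submod_closed U.
  split=> [|a _ _ /asboolP[h <-] /asboolP[h' <-]]; apply/asboolP.
    by exists (\0 : {linear G -> Y}); apply/ffunP => l; rewrite !ffunE.
  by have [k kE] := lin _ h h' a; exists k; apply/ffunP => l; rewrite !ffunE /= kE.
have TU : {subset T <= U}.
  apply: (nakayama (x := x)) => // [|_ /asboolP[h <-]].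
    exact/noetherian_mod_fpow/fingen_noetherian_mod.
  have [g gP] := ext _ _ _ _ ip (q \o h : {linear K -> Q}).
  have [g' g'P] := Gproj _ _ q g qsurj.
  have [|h' h'P] := linear_factor_inj (f := h \- (g' \o i) : {linear K -> Y}) jinj.
    by move=> k; apply/jqP; rewrite /= linearB g'P gP subrr.
  exists (ev h'); apply/asboolP; first by exists h'.
  exists g'; apply/ffunP => l; rewrite !ffunE /= -[x *: _]jE h'P /=.
  by rewrite opprB addrC subrK.
apply: (ext1_zero_presentation ip) => // h.
have /asboolP[g gP] : ev h \in U by apply: TU; apply/asboolP; exists h.
by exists g => k; rewrite -(ev_eq _ _ gP).
Qed.

End Nakayama.

(** * Syzygies of [B / x B] *)

Section Twist.
Variables (R : comNzRingType) (x : R).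
Implicit Types B G K Q W Y : lmodType R.

Fact twist_subproof G B (p : {linear G -> B}) :
  exists d : {linear dsum G B -> B}, forall u, d u = p u.1 - x *: u.2.
Proof.
apply: linear_exists => a u v; rewrite linearP scalerDr scalerA mulrC -scalerA.
by rewrite opprD addrACA scalerBr.
Qed.

Definition twist G B (p : {linear G -> B}) : {linear dsum G B -> B} :=
  sval (cid (twist_subproof p)).

(** For a cover [p : G -> B] and [x] regular on [B], the pullback of [p] along
    multiplication by [x] is a first syzygy of [B / x B]; its own syzygy is the
    same pullback formed from a cover of [ker p]. *)
Definition twist_mod G B (p : {linear G -> B}) : lmodType R := kermod (twist p).
Definition twist_val G B (p : {linear G -> B}) : {linear twist_mod p -> dsum G B} :=
  kerval (twist p).

Lemma twist_valP G B (p : {linear G -> B}) (t : twist_mod p) :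
  p (twist_val p t).1 = x *: (twist_val p t).2.
Proof.
have := kervalP (f := twist p) t; rewrite /twist (svalP (cid (twist_subproof p))).
by move/eqP; rewrite subr_eq0 => /eqP.
Qed.

Lemma twist_val_ex G B (p : {linear G -> B}) g b :
  p g = x *: b -> exists t, twist_val p t = (g, b).
Proof.
move=> e; apply: kerval_ex; rewrite /twist (svalP (cid (twist_subproof p))) /=.
by rewrite e subrr.
Qed.

Lemma twist_val_inj G B (p : {linear G -> B}) : injective (twist_val p).
Proof. exact: kerval_inj. Qed.

Lemma twist_quotient G B Q (p : {linear G -> B}) (j : {linear B -> B})
    (q : {linear B -> Q}) :
    (forall b, exists g, p g = b) -> short_exact j q -> (forall b, j b = x *: b) ->
  exists (i : {linear twist_mod p -> G}) (r : {linear G -> Q}), short_exact i r.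
Proof.
move=> psurj [jinj qsurj jq] jE.
exists ((fst : {linear dsum G B -> G}) \o twist_val p : {linear twist_mod p -> G}).
exists (q \o p : {linear G -> Q}); split=> [t t' /= e|c|g] /=.
- apply: (@twist_val_inj _ _ p); rewrite [LHS]surjective_pairing [RHS]surjective_pairing.
  by rewrite e; congr pair; apply: jinj; rewrite !jE -!twist_valP e.
- by have [b <-] := qsurj c; have [g <-] := psurj b; exists g.
split=> [/jq[b]|[t <-]]; last by apply/jq; exists (twist_val p t).2; rewrite jE twist_valP.
by rewrite jE => /esym/twist_val_ex[t tE]; exists t; rewrite tE.
Qed.

(** The formulas for [d] and [j] are those of the mapping cone of multiplication by [x] on a
    resolution of [B], hence the sign in [j]. *)
Lemma twist_syzygy K G B K2 G2 (i : {linear K -> G}) (p : {linear G -> B})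
    (i2 : {linear K2 -> G2}) (p2 : {linear G2 -> K}) :
    short_exact i p -> short_exact i2 p2 ->
  exists (j : {linear twist_mod p2 -> dsum G2 G}) (q : {linear dsum G2 G -> twist_mod p}),
    short_exact j q /\ forall t, j t = ((twist_val p2 t).1, - i (twist_val p2 t).2).
Proof.
move=> ip ip2; have [iinj psurj ipP] := ip; have [iinj2 p2surj ip2P] := ip2.
have [j jE] : exists j : {linear twist_mod p2 -> dsum G2 G},
    forall t, j t = ((twist_val p2 t).1, - i (twist_val p2 t).2).
  by apply: linear_exists => a u v; rewrite !linearP.
have [d dE] : exists d : {linear dsum G2 G -> dsum G B},
    forall u, d u = (i (p2 u.1) + x *: u.2, p u.2).
  apply: linear_exists => a u v; rewrite [p2 _]linearP [i _]linearP [p _]linearP.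
  by congr pair; rewrite /= !scalerDr !scalerA [x * a]mulrC addrACA.
have [|q qE] := linear_factor_inj (f := d) (@twist_val_inj _ _ p).
  move=> u; rewrite dE; apply: twist_val_ex.
  by rewrite linearD (short_exact0 ip) add0r linearZ.
exists j, q; split=> //; split=> [t t'|t|[g2 g]].
- rewrite !jE => -[e1 e2]; apply: (@twist_val_inj _ _ p2).
  rewrite [LHS]surjective_pairing [RHS]surjective_pairing e1; congr pair.
  by apply: iinj; apply: oppr_inj.
- have [g gE] := psurj (twist_val p t).2.
  have [k kE] : exists k, i k = (twist_val p t).1 - x *: g.
    by apply/ipP; rewrite linearB linearZ gE twist_valP subrr.
  have [g2 g2E] := p2surj k; exists (g2, g); apply: (@twist_val_inj _ _ p).
  by rewrite qE dE /= g2E kE subrK gE -surjective_pairing.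
have -> : q (g2, g) = 0 <-> i (p2 g2) + x *: g = 0 /\ p g = 0.
  split=> [e|[e1 e2]].
    by have := qE (g2, g); rewrite e linear0 dE => -[-> ->].
  by apply: (@twist_val_inj _ _ p); rewrite qE dE /= e1 e2 linear0.
split=> [[e /ipP[k kE]]|[t]].
  have [t tE] : exists t, twist_val p2 t = (g2, - k).
    apply: twist_val_ex; apply: iinj; rewrite linearZ [i (- k)]linearN kE.
    by rewrite [RHS]scalerN; apply/eqP; rewrite -addr_eq0 e.
  by exists t; rewrite jE tE /= linearN kE opprK.
rewrite jE => -[<- <-]; split; last by rewrite linearN (short_exact0 ip) oppr0.
by rewrite twist_valP linearZ [x *: - _]scalerN subrr.
Qed.

(** For [x] regular on [B] this is injectivity of [Ext^1(B, W) -> Ext^2(B / x B, W)]: the preceding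
    map of the long exact sequence is multiplication by [x], which is zero on [W]. *)
Lemma ext1_zero_untwist K G B K2 G2 W (i : {linear K -> G}) (p : {linear G -> B})
    (i2 : {linear K2 -> G2}) (p2 : {linear G2 -> K}) :
    short_exact i p -> projective G -> short_exact i2 p2 ->
    (forall w : W, x *: w = 0) ->
  ext1_zero (twist_mod p) W -> ext1_zero B W.
Proof.
move=> ip Gproj ip2 xW ext; have [j [q [jq jE]]] := twist_syzygy ip ip2.
have [_ p2surj _] := ip2.
apply: (ext1_zero_presentation ip) => // h.
have [g gP] := ext _ _ _ _ jq
  (h \o ((snd : {linear dsum G2 K -> K}) \o twist_val p2 : {linear twist_mod p2 -> K})
    : {linear twist_mod p2 -> W}).
have [e eE] : exists e : {linear G -> W}, forall b, e b = g (0, - b).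
  apply: linear_exists => a u v; rewrite -linearP; congr (g _); congr pair.
    by rewrite /= scaler0 addr0.
  by rewrite /= scalerN opprD.
exists e => k; rewrite eE; have [g2 g2E] := p2surj k.
(* Every [k] occurs as second entry next to a multiple of [x], and [g] does not see that first entry
   since [x] kills [W]. *)
have [t tE] : exists t, twist_val p2 t = (x *: g2, k).
  by apply: twist_val_ex; rewrite linearZ g2E.
have := gP t; rewrite /= jE tE /= => <-.
have -> : ((x *: g2, - i k) : dsum G2 G) = x *: ((g2, 0) : dsum G2 G) + (0, - i k).
  by congr pair; rewrite /= ?scaler0 ?addr0 ?add0r.
by rewrite linearD linearZ /= xW add0r.
Qed.

(** The second projection makes [twist_mod p] an extension of [B] by [K]. *)
Lemma ext1_zero_twist K G B Y (i : {linear K -> G}) (p : {linear G -> B}) :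
    short_exact i p -> ext1_zero B Y -> ext1_zero K Y -> ext1_zero (twist_mod p) Y.
Proof.
move=> ip extB extK; have [iinj psurj ipP] := ip.
have [u uE] : exists u : {linear K -> dsum G B}, forall k, u k = (i k, 0).
  by apply: linear_exists => a k l; rewrite linearP; congr pair; rewrite /= scaler0 addr0.
have [|j jE] := linear_factor_inj (f := u) (@twist_val_inj _ _ p).
  by move=> k; rewrite uE; apply: twist_val_ex; rewrite (short_exact0 ip) scaler0.
pose q : {linear twist_mod p -> B} := (snd : {linear dsum G B -> B}) \o twist_val p.
have jq : short_exact j q.
  split=> [k k' e|b|t].
  - by apply: iinj; have := congr1 (twist_val p) e; rewrite !jE !uE => -[].
  - have [g gE] := psurj (x *: b); have [t tE] := twist_val_ex gE.
    by exists t; rewrite /q /= tE.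
  split=> [/= qt|[k <-]]; last by rewrite /q /= jE uE.
  have /ipP[k kE] : p (twist_val p t).1 = 0 by rewrite twist_valP qt scaler0.
  exists k; apply: (@twist_val_inj _ _ p); rewrite jE uE kE -qt.
  by rewrite -surjective_pairing.
exact: ext1_zero_mid jq extK extB.
Qed.

End Twist.

Section ConstantRank.
Variable R : comNzRingType.
Local Notation S := (totfrac R).
Local Notation phi := (@tototfrac R).

Lemma tototfrac_unit (x : R) : GRing.lreg x -> exists y : S, y * phi x = 1.
Proof.
move=> xreg; exists (\pi_S%qT (mkfrac 1 xreg)).
rewrite -[LHS]/(totfrac_mul _ _) /tototfrac Defs.pi_mul.
by apply: totfrac_eq => /=; rewrite !mul1r mulr1.
Qed.

(** The regular element [x] that kills [A] becomes invertible over the total ring of fractions, so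
    only the free summand survives the base change. *)
Lemma constant_rank_torsion_free (A : lmodType R) (x : R) (n : nat) :
    GRing.lreg x -> (forall a : A, x *: a = 0) ->
  constant_rank (dsum A (fpow n R^o)) n.
Proof.
move=> xreg xA; set M := dsum A (fpow n R^o).
pose g (u : M) : 'rV[S]_n := \row_j phi (u.2 j).
have gD u v : g (u + v) = g u + g v.
  by apply/rowP => j; rewrite !mxE ffunE raddfD.
have gZ a u : g (a *: u) = phi a *: g u.
  by apply/rowP => j; rewrite !mxE ffunE -[_ *: _]/(_ * _) rmorphM.
have [l lE] : exists l : {linear free_lmod S M -> 'rV[S]_n}, l =1 freelift g.
  exact/linear_exists/freelift_linear.
have lb u : l (freebasis u) = g u by rewrite lE freelift_basis.
pose W := lspan (basechange_rel phi (M := M)).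
have [p [pE psurj pW]] := quomod_pi (W : submodClosed (free_lmod S M)).
have relW v : basechange_rel phi v -> p v = 0 by move=> vW; apply/pW; exact: lspan_mem.
pose e u : basechange phi M := p (freebasis u).
have eD u v : e (u + v) = e u + e v.
  have : p (freebasis (u + v) - freebasis u - freebasis v : free_lmod S M) = 0.
    by apply: relW; left; exists u, v.
  rewrite !linearB => h; apply/eqP; rewrite -subr_eq0 opprD addrA; exact/eqP.
have eZ a u : e (a *: u) = phi a *: e u.
  have : p (freebasis (a *: u) - phi a *: freebasis u : free_lmod S M) = 0.
    by apply: relW; right; exists a, u.
  by rewrite linearB linearZ => /eqP; rewrite subr_eq0 => /eqP.
have [|f fP] := linear_factor_surj (f := l) psurj.
  move=> v /pW; move: v; apply: lspan_ind => [|a u w lu lw|w].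
  - by rewrite linear0.
  - by rewrite linearP lu lw scaler0 addr0.
  case=> [[u [w' ->]]|[a [u ->]]].
    by rewrite !linearB /= !lb gD -addrA -opprD subrr.
  by rewrite linearB linearZ /= !lb gZ subrr.
have fe u : f (e u) = g u by rewrite fP lb.
pose d j : M := (0, fpow_delta R j).
have [E EE] : exists E : {linear 'rV[S]_n -> basechange phi M},
    forall r, E r = \sum_(j < n) r ord0 j *: e (d j).
  apply: linear_exists => a r r'; rewrite scaler_sumr -big_split /=.
  by apply: eq_bigr => j _; rewrite !mxE scalerDl scalerA.
have e0 : e 0 = 0 by apply: (addrI (e 0)); rewrite -eD !addr0.
have esum (F : 'I_n -> M) : e (\sum_(j < n) F j) = \sum_(j < n) e (F j).
  by apply: (big_morph e); [exact: eD | exact: e0].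
have eA (a : A) : e (a, 0) = 0.
  have [y yx] := tototfrac_unit xreg.
  rewrite -[LHS]scale1r -yx -scalerA -eZ.
  have -> : x *: ((a, 0) : M) = 0 by congr pair; rewrite ?xA //= scaler0.
  by rewrite e0 scaler0.
have Ef u : E (f (e u)) = e u.
  case: u => a c; rewrite fe EE.
  have [i iE] : exists i : {linear fpow n R^o -> M}, forall c, i c = (0, c).
    by apply: linear_exists => b v w; congr pair; rewrite /= scaler0 addr0.
  have acE : ((a, c) : M) = (a, 0) + \sum_(j < n) (c j : R) *: d j.
    rewrite (eq_bigr (fun j => i ((c j : R) *: fpow_delta R j))) => [|j _].
      rewrite -linear_sum -lincombE lincomb_fpow_delta iE.
      by congr pair; rewrite /= ?addr0 ?add0r.
    by rewrite linearZ iE.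
  rewrite [in RHS]acE eD eA add0r esum; apply: eq_bigr => j _.
  by rewrite eZ mxE.
exists f; apply: (Bijective (g := E)) => [b|r].
  have [v <-] := psurj b.
  apply: (freemod_span (f := E \o (f \o p)) (g := p)) => u.
  exact: Ef.
apply/rowP => j; rewrite EE linear_sum summxE (bigD1 j) //= big1 => [|k kj].
  by rewrite linearZ /= fe !mxE ffunE eqxx rmorph1 mulr1 addr0.
by rewrite linearZ /= fe !mxE ffunE eq_sym (negPf kj) rmorph0 mulr0.
Qed.

End ConstantRank.

(** * The implication (3) => (1) *)

Section RfedRank.
Variable R : comNzRingType.
Hypothesis Rnoeth : noetherian R.
Variable m : {pred R}.
Hypothesis mlocal : local_ring m.
Implicit Types M Y Q : lmodType R.
Local Notation syz := (syz Rnoeth mlocal).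
Local Notation cover n M := (mincover Rnoeth mlocal (syz n M)).

Lemma depth_gt0 : (0 < depth m)%E -> exists2 x : R, x \in m & GRing.lreg x.
Proof.
move=> m0; apply: contrapT => nox; move: m0; apply/negP; rewrite -leNgt.
apply: ge_ereal_sup => _ [s [[sreg _] sm] <-]; case: s sreg sm => [|x s] sreg sm //.
case: nox; exists x; first by apply: sm; exact: mem_head.
move=> a b e; apply/eqP; rewrite -subr_eq0; apply/eqP.
have nil0 (y : R^o) : y \in lspan [set` take 0 (x :: s)] -> y = 0.
  by move: y; apply: lspan_ind => // a' u v -> ->; rewrite scaler0 addr0.
apply/nil0/(sreg 0%N) => //=; rewrite mulrBr e subrr; exact: rpred0.
Qed.

Lemma fpow_regular (x : R) n : GRing.lreg x ->
  forall v : fpow n R^o, x *: v = 0 -> v = 0.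
Proof.
move=> xreg v xv; apply/ffunP => j; apply: xreg; rewrite ffunE mulr0.
by have := congr1 (fun w : fpow n R^o => w j) xv; rewrite !ffunE.
Qed.

Lemma syz_regular (x : R) n M : GRing.lreg x ->
  forall v : syz n.+1 M, x *: v = 0 -> v = 0.
Proof.
move=> xreg v xv; apply: (kerval_inj (f := cover n M)); rewrite linear0.
by apply: (fpow_regular xreg); rewrite -linearZ xv linear0.
Qed.

Lemma ext_zero_twist_cover x n k M Y : fingen M ->
  ext_zero n (twist_mod x (cover k M)) Y <->
  ext1_zero (twist_mod x (cover (n + k) M)) Y.
Proof.
move=> Mfg; elim: n k => [|n IHn] k //.
have ip := minsyz_short_exact Rnoeth mlocal (fingen_syz Rnoeth mlocal k Mfg).
have ip2 := minsyz_short_exact Rnoeth mlocal (fingen_syz Rnoeth mlocal k.+1 Mfg).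
have [j [q [jq _]]] := twist_syzygy x ip ip2.
rewrite (ext_zero_syzygy _ _ jq); last by apply: projective_pair; exact: fpow_projective.
by rewrite IHn addnS.
Qed.

(** The twisted cover of [syz k M] is a first syzygy of [Q], and each further syzygy raises the
    index of the cover by one; so degree [n + 2] for [Q] is read at index [n + k]. *)
Lemma ext_zero_quotient x k M Q Y (j : {linear syz k M -> syz k M})
    (q : {linear syz k M -> Q}) n : fingen M ->
    short_exact j q -> (forall v, j v = x *: v) ->
  ext_zero n.+1 Q Y <-> ext1_zero (twist_mod x (cover (n + k) M)) Y.
Proof.
move=> Mfg jq jE.
have [psurj _] := mincoverP Rnoeth mlocal (fingen_syz Rnoeth mlocal k Mfg).
have [i [r ir]] := twist_quotient psurj jq jE.
by rewrite (ext_zero_syzygy _ _ ir) ?ext_zero_twist_cover //; exact: fpow_projective.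
Qed.

Lemma rfed_rank_SAC n : (0 < depth m)%E -> (rfed_rank R n < +oo)%E -> SAC R.
Proof.
move=> /depth_gt0[x xm xreg] /ereal_nat_bound[D RD] M Mfg extMR [k0 extMM].
have extR i : ext1_zero (syz i M) R^o.
  by apply/(ext_zero_syz Rnoeth mlocal) => //; apply/Ext_eq0S; exact: extMR.
have extM i : (k0 <= i)%N -> ext1_zero (syz i M) M.
  move=> ki; apply/(ext_zero_syz Rnoeth mlocal) => //.
  by apply/Ext_eq0S; apply: extMM; exact: leqW.
have extS := ext1_zero_syz_syz Mfg (fun i _ => extR i) extM.
have [Q1 [j1 [q1 [jq1 j1E xQ1]]]] := regular_quotient (syz_regular (n := 0) (M := M) xreg).
have [Q2 [j2 [q2 [jq2 j2E xQ2]]]] := regular_quotient (syz_regular (n := D) (M := M) xreg).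
pose C := dsum (dsum Q1 Q2) (fpow n R^o).
have Qfg k Q (j : {linear syz k M -> syz k M}) (q : {linear syz k M -> Q}) :
    short_exact j q -> fingen Q.
  by move=> [_ qsurj _]; apply: (fingen_surj qsurj); exact: fingen_syz.
have Cfg : fingen C.
  apply: fingen_dsum; first by apply: fingen_dsum; [exact: Qfg jq1 | exact: Qfg jq2].
  apply/fingenP; exists n, (@fpow_delta R n) => c.
  by exists c; exact: lincomb_fpow_delta.
have Crank : constant_rank C n.
  apply: (constant_rank_torsion_free (x := x)) => // -[a b].
  by congr pair; [exact: xQ1 | exact: xQ2].
have twistS a Y : ext1_zero (syz a M) Y -> ext1_zero (syz a.+1 M) Y ->
    ext1_zero (twist_mod x (cover a M)) Y.
  apply: ext1_zero_twist; by apply: minsyz_short_exact; exact: fingen_syz.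
have Q1ext i Y := @ext_zero_quotient x 1 M Q1 Y j1 q1 i Mfg jq1 j1E.
have Q2ext i Y := @ext_zero_quotient x D.+1 M Q2 Y j2 q2 i Mfg jq2 j2E.
(* The twisted covers that arise for [Q1] and [Q2] are extensions of [syz a M] by [syz a.+1 M] with
   [a >= i], so vanishing for the syzygies of [M] passes to [C]. *)
have Cext i Y : (forall a, (i <= a)%N -> ext1_zero (syz a M) Y) -> ext_zero i.+1 C Y.
  move=> extY; apply/ext_zero_dsum; split; last first.
    by apply: projective_ext_zero; exact: fpow_projective.
  apply/ext_zero_dsum; split; [apply/Q1ext|apply/Q2ext]; apply: twistS; apply: extY.
  - exact: leq_addr.
  - by apply: leqW; exact: leq_addr.
  - exact: leq_addr.
  - by apply: leqW; exact: leq_addr.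
have quotext k Q (j : {linear syz k M -> syz k M}) (q : {linear syz k M -> Q}) a :
    short_exact j q -> (k0 + k <= a)%N -> ext1_zero (syz a M) Q.
  move=> jq ka; have [i [p ip]] := syz_short_exact Rnoeth mlocal a Mfg.
  apply: (ext1_zero_quot ip _ jq); [exact: fpow_projective | exact: extS|].
  by apply: extS; exact: leqW.
have Cfin : (ext_deg (dsum C R^o) < +oo)%E.
  (* The threshold for [Q2], a quotient of [syz D.+1 M], also covers [Q1]; the outer successor is
     the shift from [Cext i] to [ext_zero i.+1]. *)
  apply/ext_deg_dsum_fin; exists (k0 + D.+1).+1 => -[|i] //; rewrite ltnS => ki.
  split; last by apply: Cext => a _; exact: extR.
  apply: Cext => a ia; have ka : (k0 + D.+1 <= a)%N by exact: leq_trans ia.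
  apply: (ext_zero_dsumr 0 _ _ _).2; split; last exact: ext1_zero_fpow.
  apply: (ext_zero_dsumr 0 _ _ _).2; split; last exact: quotext jq2 ka.
  by apply: (quotext _ _ _ _ _ jq1); apply: leq_trans ka; rewrite leq_add2l.
(* [D] bounds all modules of rank [n] at once, so it applies to [C] although [C] was built from
   [D]. *)
have CD : (ext_deg (dsum C R^o) <= (D%:R)%:E)%E.
  by apply: le_trans RD; apply: ereal_sup_ubound; exists C; split.
have extQ a : ext1_zero (syz (a + D.+1) M) (syz D.+1 M).
  have ip := minsyz_short_exact Rnoeth mlocal (fingen_syz Rnoeth mlocal (a + D.+1) Mfg).
  have ip2 := minsyz_short_exact Rnoeth mlocal (fingen_syz Rnoeth mlocal (a + D.+1).+1 Mfg).
  have Kfg := fingen_syz Rnoeth mlocal (a + D.+1).+1 Mfg.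
  have Yfg := fingen_syz Rnoeth mlocal D.+1 Mfg.
  apply: (ext1_zero_nakayama Rnoeth mlocal ip _ Kfg jq2 j2E Yfg xm).
    exact: fpow_projective.
  apply: (ext1_zero_untwist (x := x) ip _ ip2 xQ2); first exact: fpow_projective.
  (* Degree [a + D + 2] for [Q1] is one more than the corresponding degree for [syz 1 M], because of
     the connecting map, and so matches [Ext^1] of [syz (a + D.+1) M]. *)
  have /ext_deg_le/(_ (a + D).+2) := CD.
  rewrite ltnS leqW ?leq_addl // => /(_ isT)/Ext_eq0S.
  move=> /ext_zero_dsum[/ext_zero_dsumr[ext _] _].
  have /ext_zero_dsum[/ext_zero_dsum[ext1 _] _] := ext.
  have /ext_zero_dsumr[/ext_zero_dsumr[_ /Q1ext ext12] _] := ext1.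
  by move: ext12; rewrite addn1 addnS.
move=> [|a] // _; apply/Ext_eq0S/(ext_zero_syz Rnoeth mlocal) => //.
(* Removing [D + 1] syzygies from both arguments turns [extQ a] into [Ext^(a+1)(M, M) = 0]. *)
have down l : ext1_zero (syz (a + l) M) (syz l M) -> ext1_zero (syz a M) (syz 0 M).
  elim: l => [|l IHl]; first by rewrite addn0.
  by rewrite addnS => ext; apply: IHl; apply: ext1_zero_syz_down ext.
exact: (down D.+1).
Qed.

End RfedRank.

Theorem theorem6p5 (R : comNzRingType) (m : {pred R}) :
  noetherian R -> local_ring m -> (0 < depth m)%E ->
  [<-> SAC R; (rfed R < +oo)%E; exists n : nat, (rfed_rank R n < +oo)%E].
Proof.
move=> Rnoeth mlocal m0; tfae.
- exact: (SAC_rfed Rnoeth mlocal).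
- move=> Rfin; exists 0%N; apply: le_lt_trans Rfin; apply: ge_ereal_sup => _ [M [Mfg _ -> Mfin]].
  by apply: ereal_sup_ubound; exists M.
by move=> [n]; exact: (rfed_rank_SAC Rnoeth mlocal m0).
Qed.
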